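(* Let $k$ be an algebraically closed field, $A=kQ$ the path algebra of a finite quiver $Q$, $T$ a finite-dimensional left $A$-module, and $A[T]$ the one-point extension of $A$ by $T$. For all finite-dimensional $A[T]$-modules $\tilde M,\tilde N$, the homological Euler form $\langle\tilde M,\tilde N\rangle_{A[T]}=\sum_{i\ge0}(-1)^i\dim\mathrm{Ext}^i_{A[T]}(\tilde M,\tilde N)$ satisfies \[ \langle\tilde M,\tilde N\rangle_{A[T]}=\langle\underline{\dim}\,\tilde M,\underline{\dim}\,\tilde N\rangle_{A[T]}, \] where for dimension vectors $(s,d),(s',d')$ one sets \[ \langle(s,d),(s',d')\rangle_{A[T]}:=ss'-s\cdot\langle\underline{\dim}\,T,d'\rangle_Q+\langle d,d'\rangle_Q . \]
   Context: $A[T]$ is the $k$-algebra of formal matrices $\begin{pmatrix} a & t\\ 0&\lambda\end{pmatrix}$ with $a\in A$, $t\in T$, $\lambda\in k$, with componentwise addition and formal matrix multiplication. Left $A[T]$-modules are identified with triples $(M,V,f)$ where $M$ is a left $A$-module, $V$ a $k$-vector space and $f:T\otimes_kV\to M$ an $A$-module map; a morphism $(M,V,f)\to(N,W,g)$ is a pair $(\varphi_1:M\to N\text{ $A$-linear},\ \varphi_2:V\to W\text{ $k$-linear})$ with $\varphi_1f=g(\mathrm{id}_T\otimes\varphi_2)$. The dimension vector of $(M,V,f)$ is $(s,d)\in\mathbb N\times\mathbb N^{Q_0}$ with $s=\dim V$ and $d=\underline{\dim}\,M=(\dim e_iM)_{i\in Q_0}$. The Euler form of $Q$ is $\langle d,e\rangle_Q=\sum_{i\in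 Q_0}d_ie_i-\sum_{(\alpha:i\to j)\in Q_1}d_ie_j$. *)

(* Defs.v *)
From HB Require Import structures.
From mathcomp Require Import all_boot all_order all_algebra.
From mathcomp Require Import finmap.
From mathcomp Require Import boolp classical_sets functions cardinality fsbigop.
From mathcomp.multinomials Require Import monalg.

Set Implicit Arguments.
Unset Strict Implicit.
Unset Printing Implicit Defensive.

Import GRing.Theory.
Local Open Scope ring_scope.
Local Open Scope classical_set_scope.

Section LinearExtension.
Variables (R : nzRingType) (X : choiceType) (V : lmodType R).

(* {malg R[X]} is the free left R-module on X, with basis << x >>. *)
Definition lift (h : X -> V) (f : {malg R[X]}) : V :=
  \sum_(x <- msupp f) f@_x *: h x.

Lemma liftEw (h : X -> V) (d : {fset X}) (f : {malg R[X]}) :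
  fsubset (msupp f) d -> lift h f = \sum_(x <- d) f@_x *: h x.
Proof.
move=> fd; rewrite /lift (big_fset_incl _ fd) // => x xd xf.
by rewrite mcoeff_outdom // scale0r.
Qed.

Lemma lift_is_linear (h : X -> V) : linear (lift h).
Proof.
move=> a f g.
pose d := fsetU (msupp f) (fsetU (msupp g) (msupp (a *: f + g))).
rewrite (@liftEw h d f); last by rewrite /d fsubsetUl.
rewrite (@liftEw h d g); last by rewrite /d fsetUCA fsubsetUl.
rewrite (@liftEw h d (a *: f + g)); last by rewrite /d fsetUA fsubsetUr.
rewrite scaler_sumr -big_split; apply: eq_bigr => x _ /=.
by rewrite mcoeffD mcoeffZ scalerDl scalerA.
Qed.

HB.instance Definition _ (h : X -> V) :=
  GRing.isLinear.Build R {malg R[X]} V _ (lift h) (lift_is_linear h).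

Lemma liftU (h : X -> V) (x : X) : lift h << x >> = h x.
Proof.
by rewrite (liftEw _ msuppU_le) big_seq_fset1 mcoeffUU scale1r.
Qed.

Lemma eq_lift (g h : X -> V) : g =1 h -> lift g =1 lift h.
Proof. by move=> gh f; apply: eq_bigr => x _; rewrite gh. Qed.

Lemma lift0 (f : {malg R[X]}) : lift (fun _ => 0) f = 0.
Proof. by rewrite /lift big1 // => x _; rewrite scaler0. Qed.

End LinearExtension.

Lemma linear_lift (R : nzRingType) (X : choiceType) (V W : lmodType R)
    (g : {linear V -> W}) (h : X -> V) (f : {malg R[X]}) :
  g (lift h f) = lift (g \o h) f.
Proof. by rewrite linear_sum; apply: eq_bigr => x _; rewrite linearZ. Qed.

Lemma lift_basis (R : nzRingType) (X : choiceType) (f : {malg R[X]}) :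
  lift (fun x => << x >>) f = f.
Proof.
rewrite /lift [RHS]monalgE; apply: eq_bigr => x _.
by apply/malgP => y; rewrite mcoeffZ !mcoeffU mulr_natr.
Qed.

Record quiver := Quiver {
  vertex : finType;
  arrow : finType;
  source : arrow -> vertex;
  target : arrow -> vertex }.

Section Paths.
Variable Q : quiver.

Fixpoint walk (i : vertex Q) (s : seq (arrow Q)) : bool :=
  if s is a :: s' then (source a == i) && walk (target a) s' else true.

Definition walk_end (i : vertex Q) (s : seq (arrow Q)) : vertex Q :=
  last i (map (@target Q) s).

(* A starting vertex with the arrows travelled, in order. *)
Record qpath := QPath {
  path_val : vertex Q * seq (arrow Q);
  _ : walk path_val.1 path_val.2 }.
HB.instance Definition _ := [isSub for path_val].
HB.instance Definition _ := [Choice of qpath by <:].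

Definition path_source (p : qpath) : vertex Q := (val p).1.
Definition path_target (p : qpath) : vertex Q :=
  walk_end (val p).1 (val p).2.

Definition trivial_path (i : vertex Q) : qpath :=
  @QPath (i, [::]) isT.

Lemma walk_cat i s t : walk i (s ++ t) = walk i s && walk (walk_end i s) t.
Proof. by elim: s i => //= a s IHs i; rewrite IHs andbA. Qed.

Lemma walk_end_cat i s t : walk_end i (s ++ t) = walk_end (walk_end i s) t.
Proof. by rewrite /walk_end map_cat last_cat. Qed.

(* Arrows are composed like functions: the product p q runs along q first.
   With this convention, a left kQ-module is a representation in which an
   arrow a : i -> j acts as a linear map from e_i M to e_j M. *)
Definition path_comp (p q : qpath) : option qpath :=
  if path_target q == path_source p
  then insub ((val q).1, (val q).2 ++ (val p).2) else None.

Lemma path_compP p q : path_target q = path_source p ->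
  exists2 r : qpath, path_comp p q = Some r &
    val r = ((val q).1, (val q).2 ++ (val p).2).
Proof.
move=> pq; rewrite /path_comp pq eqxx; case: insubP => [r _ rE|]; first by exists r.
rewrite /= walk_cat (valP q) /=; move: pq.
by rewrite /path_target /path_source => ->; rewrite (valP p).
Qed.

Lemma path_compN p q : path_target q <> path_source p -> path_comp p q = None.
Proof. by move=> /eqP/negPf pq; rewrite /path_comp pq. Qed.

Lemma path_compA p q r :
  obind (fun s => path_comp s r) (path_comp p q) =
  obind (path_comp p) (path_comp q r).
Proof.
case: (path_target q =P path_source p) => [pq|npq]; last first.
  rewrite (path_compN npq) /=.
  case: (path_target r =P path_source q) => [qr|nqr]; last by rewrite path_compN.
  have [s -> sE] := path_compP qr.
  rewrite /= path_compN // /path_target sE /= walk_end_cat.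
  by move: qr npq; rewrite /path_target /path_source => ->.
have [s -> sE] := path_compP pq.
case: (path_target r =P path_source q) => [qr|nqr]; last first.
  by rewrite (path_compN nqr) /= path_compN // /path_source sE.
have [t -> tE] := path_compP qr.
rewrite /=.
have rs : path_target r = path_source s by rewrite /path_source sE.
have tp : path_target t = path_source p.
  rewrite /path_target tE /= walk_end_cat -pq.
  by move: qr; rewrite /path_target /path_source => ->.
have [u -> uE] := path_compP rs; have [v -> vE] := path_compP tp.
by congr Some; apply: val_inj; rewrite uE vE sE tE /= catA.
Qed.

Lemma path_comp1p i p :
  path_comp (trivial_path i) p = if path_target p == i then Some p else None.
Proof.
case: eqP => [pi|npi]; last exact: path_compN.
have [r -> rE] := path_compP (p := trivial_path i) pi.
by congr Some; apply: val_inj; rewrite rE /= cats0; clear pi rE; case: p => -[].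
Qed.

Lemma path_compp1 p i :
  path_comp p (trivial_path i) = if path_source p == i then Some p else None.
Proof.
case: (path_source p =P i) => [pi|npi]; last first.
  by rewrite path_compN // => /esym.
have [r -> rE] := path_compP (p := p) (q := trivial_path i) (esym pi).
by congr Some; apply: val_inj; rewrite rE /= -pi; clear pi rE; case: p => -[].
Qed.

End Paths.

Definition path_algebra (k : fieldType) (Q : quiver) : Type :=
  {malg k[qpath Q]}.
HB.instance Definition _ (k : fieldType) (Q : quiver) :=
  GRing.Lmodule.on (path_algebra k Q).

(* Locked, so that unification does not unfold finitely supported functions. *)
HB.lock Definition pa_path (k : fieldType) (Q : quiver) (p : qpath Q) :
  path_algebra k Q := << p >>.

Definition path_mul (k : fieldType) (Q : quiver) (p q : qpath Q) :
    path_algebra k Q :=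
  if path_comp p q is Some r then pa_path k r else 0.

HB.lock Definition pa_mul (k : fieldType) (Q : quiver)
    (f g : path_algebra k Q) : path_algebra k Q :=
  \sum_(p <- msupp f) f@_p *: \sum_(q <- msupp g) g@_q *: path_mul k p q.

Section PathAlgebra.
Variables (k : fieldType) (Q : quiver).
Local Notation path_algebra := (path_algebra k Q).
Local Notation pa_path := (@pa_path k Q).
Local Notation path_mul := (@path_mul k Q).
Local Notation pa_mul := (@pa_mul k Q).

Definition pa_one : path_algebra := \sum_(i : vertex Q) pa_path (trivial_path i).

Lemma pa_mulE f g :
  pa_mul f g = lift (fun p => lift (path_mul p : _ -> {malg k[qpath Q]}) g) f.
Proof. by rewrite pa_mul.unlock. Qed.

Definition pa_rmul (g f : path_algebra) : path_algebra := pa_mul f g.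

Lemma pa_mul_linearl g : linear (pa_rmul g).
Proof. by move=> a f f'; rewrite /pa_rmul !pa_mulE linearP. Qed.

Lemma pa_mul_linearr f : linear (pa_mul f).
Proof.
move=> a g g'; rewrite !pa_mulE /lift scaler_sumr -big_split.
apply: eq_bigr => p _ /=; rewrite -!/(lift _ _) linearP scalerDr !scalerA.
by rewrite mulrC.
Qed.

HB.instance Definition _ f := GRing.isLinear.Build k path_algebra path_algebra
  _ (pa_mul f) (pa_mul_linearr f).
HB.instance Definition _ g := GRing.isLinear.Build k path_algebra path_algebra
  _ (pa_rmul g) (pa_mul_linearl g).

Lemma pa_mulUU p q : pa_mul (pa_path p) (pa_path q) = path_mul p q.
Proof. by rewrite pa_mulE pa_path.unlock !liftU. Qed.

Lemma pa_mulUr f q :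
  pa_mul f (pa_path q) = lift (path_mul^~ q : _ -> {malg k[qpath Q]}) f.
Proof. by rewrite pa_mulE; apply: eq_lift => p; rewrite pa_path.unlock liftU. Qed.

Lemma pa_ext (F G : {linear path_algebra -> path_algebra}) :
  (forall p, F (pa_path p) = G (pa_path p)) -> F =1 G.
Proof.
move=> FG f; rewrite -[f](lift_basis (f : {malg k[qpath Q]})) !linear_lift.
by apply: eq_lift => p /=; have := FG p; rewrite pa_path.unlock.
Qed.

Lemma pa_mul0l g : pa_mul 0 g = 0.
Proof. exact: (raddf0 (pa_rmul g)). Qed.

Lemma pa_mul0r f : pa_mul f 0 = 0.
Proof. exact: raddf0. Qed.

Lemma pa_mul_suml (F : vertex Q -> path_algebra) g :
  pa_mul (\sum_i F i) g = \sum_i pa_mul (F i) g.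
Proof. exact: (raddf_sum (pa_rmul g)). Qed.

Lemma pa_mul_sumr f (F : vertex Q -> path_algebra) :
  pa_mul f (\sum_i F i) = \sum_i pa_mul f (F i).
Proof. exact: raddf_sum. Qed.

Lemma path_mulA p q r :
  pa_mul (path_mul p q) (pa_path r) = pa_mul (pa_path p) (path_mul q r).
Proof.
have := path_compA p q r; rewrite /path_mul.
case: (path_comp p q) => [s|]; case: (path_comp q r) => [t|] /= E.
- by rewrite (pa_mulUU s) (pa_mulUU p) /path_mul E.
- by rewrite (pa_mulUU s) pa_mul0r /path_mul E.
- by rewrite (pa_mulUU p) pa_mul0l /path_mul -E.
- by rewrite pa_mul0l pa_mul0r.
Qed.

Lemma pa_mulA : associative pa_mul.
Proof.
move=> f g h.
pose c1 (u : path_algebra) : {linear path_algebra -> path_algebra} := pa_mul u.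
pose c2 (u : path_algebra) : {linear path_algebra -> path_algebra} := pa_rmul u.
apply: (pa_ext (F := c2 (pa_mul g h)) (G := c2 h \o c2 g)) => p /=.
apply: (pa_ext (F := c1 (pa_path p) \o c2 h) (G := c2 h \o c1 (pa_path p))) => q /=.
apply: (pa_ext (F := c1 (pa_path p) \o c1 (pa_path q)) (G := c1 (pa_mul (pa_path p) (pa_path q)))) => r /=.
rewrite /c1 /c2 /pa_rmul (pa_mulUU q r) (pa_mulUU p q).
exact/esym/path_mulA.
Qed.

Lemma pa_mul1 : left_id pa_one pa_mul.
Proof.
move=> f.
pose c1 (u : path_algebra) : {linear path_algebra -> path_algebra} := pa_mul u.
apply: (pa_ext (F := c1 pa_one) (G := idfun)) => p /=.
rewrite pa_mul_suml.
rewrite (bigD1 (path_target p)) //= big1 ?addr0 => [|i ip];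
  rewrite pa_mulUU /path_mul path_comp1p ?eqxx //.
by rewrite eq_sym (negPf ip).
Qed.

Lemma pa_mulr1 : right_id pa_one pa_mul.
Proof.
move=> f.
pose c2 (u : path_algebra) : {linear path_algebra -> path_algebra} := pa_rmul u.
apply: (pa_ext (F := c2 pa_one) (G := idfun)) => p /=.
rewrite /pa_rmul pa_mul_sumr.
rewrite (bigD1 (path_source p)) //= big1 ?addr0 => [|i ip];
  rewrite pa_mulUU /path_mul path_compp1 ?eqxx //.
by rewrite eq_sym (negPf ip).
Qed.

Lemma pa_mulDl : left_distributive pa_mul +%R.
Proof. by move=> f g h; exact: (raddfD (pa_rmul h)). Qed.

Lemma pa_mulDr : right_distributive pa_mul +%R.
Proof. by move=> f g h; exact: (raddfD (pa_mul f)). Qed.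

(* Only a pzRingType: for the quiver without vertices, kQ is the zero ring. *)
HB.instance Definition _ := GRing.Zmodule_isPzRing.Build path_algebra
  pa_mulA pa_mul1 pa_mulr1 pa_mulDl pa_mulDr.

Lemma pa_scaleAl (c : k) (f g : path_algebra) : c *: (f * g) = (c *: f) * g.
Proof. by rewrite -[RHS]/(pa_rmul g (c *: f)) linearZ. Qed.

Lemma pa_scaleAr (c : k) (f g : path_algebra) : c *: (f * g) = f * (c *: g).
Proof. by rewrite -[RHS]/(pa_mul f (c *: g)) linearZ. Qed.

Definition vertex_idem (i : vertex Q) : path_algebra := pa_path (trivial_path i).

Definition pa_const (c : k) : path_algebra := c *: (1 : path_algebra).

Lemma pa_const_additive : zmod_morphism pa_const.
Proof. by move=> a b; rewrite /pa_const scalerBl. Qed.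

Lemma pa_const_multiplicative : monoid_morphism pa_const.
Proof.
split=> [|a b]; first by rewrite /pa_const scale1r.
by rewrite /pa_const -pa_scaleAl mul1r scalerA.
Qed.

HB.instance Definition _ :=
  GRing.isZmodMorphism.Build k path_algebra pa_const pa_const_additive.
HB.instance Definition _ :=
  GRing.isMonoidMorphism.Build k path_algebra pa_const pa_const_multiplicative.

Lemma pa_const_comm (c : k) (f : path_algebra) : pa_const c * f = f * pa_const c.
Proof. by rewrite /pa_const -pa_scaleAl -pa_scaleAr mul1r mulr1. Qed.

End PathAlgebra.

Section OnePointExtension.
(* A k-algebra A is a ring with a central ring morphism phi from k; unlike
   MathComp's algType, this allows A = 0. *)
Variables (k : fieldType) (A : pzRingType) (phi : {rmorphism k -> A}).

Definition central_morph : Prop := forall c a, phi c * a = a * phi c.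

(* The triple (a, t, l) is the matrix with rows (a t) and (0 l). *)
Definition one_point_ext (phiC : central_morph) (T : lmodType A) : Type :=
  (A * T * k)%type.
HB.instance Definition _ phiC T := GRing.Zmodule.on (one_point_ext phiC T).

Variables (phiC : central_morph) (T : lmodType A).
Local Notation ope := (one_point_ext phiC T).

Definition ope_one : ope := (1, 0, 1).

Definition ope_mul (x y : ope) : ope :=
  (x.1.1 * y.1.1, x.1.1 *: y.1.2 + phi y.2 *: x.1.2, x.2 * y.2).

Definition ope_scale (c : k) (x : ope) : ope :=
  (phi c * x.1.1, phi c *: x.1.2, c * x.2).

Lemma ope_mulA : associative ope_mul.
Proof.
move=> [[a t] l] [[b u] m] [[c v] n]; congr (_, _, _) => /=.
- exact: mulrA.
- rewrite !scalerDr !scalerA addrA -phiC mulrC.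
  by rewrite (rmorphM phi).
- exact: mulrA.
Qed.

Lemma ope_mul1 : left_id ope_one ope_mul.
Proof.
move=> [[a t] l]; congr (_, _, _) => /=.
- exact: mul1r.
- by rewrite scaler0 scale1r addr0.
- exact: mul1r.
Qed.

Lemma ope_mulr1 : right_id ope_one ope_mul.
Proof.
move=> [[a t] l]; congr (_, _, _) => /=.
- exact: mulr1.
- by rewrite scaler0 (rmorph1 (phi)) scale1r add0r.
- exact: mulr1.
Qed.

Lemma ope_mulDl : left_distributive ope_mul +%R.
Proof.
move=> [[a t] l] [[b u] m] [[c v] n]; congr (_, _, _) => /=.
- exact: mulrDl.
- by rewrite scalerDl scalerDr addrACA.
- exact: mulrDl.
Qed.

Lemma ope_mulDr : right_distributive ope_mul +%R.
Proof.
move=> [[a t] l] [[b u] m] [[c v] n]; congr (_, _, _) => /=.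
- exact: mulrDr.
- by rewrite scalerDr (rmorphD (phi)) scalerDl addrACA.
- exact: mulrDr.
Qed.

Lemma ope_oner_neq0 : ope_one != 0.
Proof. by apply/eqP => -[_ /eqP]; rewrite oner_eq0. Qed.

HB.instance Definition _ := GRing.Zmodule_isNzRing.Build ope
  ope_mulA ope_mul1 ope_mulr1 ope_mulDl ope_mulDr ope_oner_neq0.

Lemma ope_scaleA a b x : ope_scale a (ope_scale b x) = ope_scale (a * b) x.
Proof.
congr (_, _, _) => /=.
- by rewrite mulrA (rmorphM phi).
- by rewrite scalerA (rmorphM phi).
- exact: mulrA.
Qed.

Lemma ope_scale1 : left_id 1 ope_scale.
Proof.
move=> [[a t] l]; congr (_, _, _) => /=.
- by rewrite (rmorph1 phi) mul1r.
- by rewrite (rmorph1 (phi)) scale1r.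
- exact: mul1r.
Qed.

Lemma ope_scaleDr : right_distributive ope_scale +%R.
Proof.
move=> c x y; congr (_, _, _) => /=.
- exact: mulrDr.
- exact: scalerDr.
- exact: mulrDr.
Qed.

Lemma ope_scaleDl x : {morph ope_scale^~ x : a b / a + b}.
Proof.
move=> a b; congr (_, _, _) => /=.
- by rewrite (rmorphD phi) mulrDl.
- by rewrite (rmorphD (phi)) scalerDl.
- exact: mulrDl.
Qed.

HB.instance Definition _ := GRing.Zmodule_isLmodule.Build k ope
  ope_scaleA ope_scale1 ope_scaleDr ope_scaleDl.

Lemma ope_scaleAl (c : k) (x y : ope) : c *: (x * y) = (c *: x) * y.
Proof.
case: x y => [[a t] l] [[b u] m]; congr (_, _, _) => /=.
- exact: mulrA.
- rewrite scalerDr !scalerA -!(rmorphM phi).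
  by rewrite mulrC.
- exact: mulrA.
Qed.

HB.instance Definition _ := GRing.Lmodule_isLalgebra.Build k ope ope_scaleAl.

Lemma ope_scaleAr (c : k) (x y : ope) : c *: (x * y) = x * (c *: y).
Proof.
case: x y => [[a t] l] [[b u] m]; congr (_, _, _) => /=.
- by rewrite !mulrA phiC.
- by rewrite scalerDr !scalerA phiC -(rmorphM phi).
- exact: mulrCA.
Qed.

HB.instance Definition _ := GRing.Lalgebra_isAlgebra.Build k ope ope_scaleAr.

(* A left module X is the triple (M, V, f) with M = ope_A 1 *: X, where A acts
   through ope_A, and V = ope_pt *: X; in particular a *: M = ope_A a *: X. *)
Definition ope_A (a : A) : ope := (a, 0, 0).
Definition ope_pt : ope := (0, 0, 1).

End OnePointExtension.

Section Restriction.
Variables (k : fieldType) (R : pzRingType).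

Definition restr (phi : {rmorphism k -> R}) (M : lmodType R) : Type := M.
HB.instance Definition _ (phi : {rmorphism k -> R}) (M : lmodType R) :=
  GRing.Zmodule.on (restr phi M).

Variables (phi : {rmorphism k -> R}) (M : lmodType R).
Local Notation kM := (restr phi M).

Definition restr_scale (c : k) (x : kM) : kM := phi c *: (x : M).

Lemma restr_scaleA a b x :
  restr_scale a (restr_scale b x) = restr_scale (a * b) x.
Proof. by rewrite /restr_scale scalerA rmorphM. Qed.

Lemma restr_scale1 : left_id 1 restr_scale.
Proof. by move=> x; rewrite /restr_scale rmorph1 scale1r. Qed.

Lemma restr_scaleDr : right_distributive restr_scale +%R.
Proof. by move=> c x y; exact: scalerDr. Qed.

Lemma restr_scaleDl x : {morph restr_scale^~ x : a b / a + b}.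
Proof. by move=> a b; rewrite /restr_scale rmorphD; exact: scalerDl. Qed.

HB.instance Definition _ := GRing.Zmodule_isLmodule.Build k kM
  restr_scaleA restr_scale1 restr_scaleDr restr_scaleDl.

End Restriction.

Section Dimension.
Variables (k : fieldType) (V : lmodType k).

(* For subspaces W of U, the classes of the e i form a basis of U / W. *)
Definition quot_basis (U W : set V) (n : nat) (e : 'I_n -> V) : Prop :=
  (forall i, U (e i)) /\
  (forall v, U v -> exists! c : 'rV[k]_n, W (v - \sum_(i < n) c 0 i *: e i)).

Definition has_quot_dim (U W : set V) (n : nat) : Prop :=
  exists e : 'I_n -> V, quot_basis U W e.

Definition quot_findim (U W : set V) : Prop := exists n, has_quot_dim U W n.

(* 0 if the quotient is infinite-dimensional. *)
Definition quot_dim (U W : set V) : nat := xget 0%N [set n | has_quot_dim U W n].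

Definition subspace_dim (U : set V) : nat := quot_dim U [set 0].

Definition findim : Prop := quot_findim [set: V] [set 0].

End Dimension.

Arguments findim {k} V.

Section Resolutions.
Variable R : nzRingType.

Definition projective (P : lmodType R) : Prop :=
  forall (M N : lmodType R) (g : {linear M -> N}) (f : {linear P -> N}),
    (forall y, exists x, g x = y) ->
    exists h : {linear P -> M}, forall x, g (h x) = f x.

Record resolution (M : lmodType R) := Resolution {
  res_mod : nat -> lmodType R;
  res_diff : forall n, {linear res_mod n.+1 -> res_mod n};
  res_aug : {linear res_mod 0 -> M};
  res_projective : forall n, projective (res_mod n);
  res_aug_surj : forall m, exists x, res_aug x = m;
  res_exact0 : forall x, res_aug x = 0 <-> exists y, res_diff 0 y = x;
  res_exact : forall n x,
    res_diff n x = 0 <-> exists y, res_diff n.+1 y = x }.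

Section FreeCover.
Variable M : lmodType R.

Definition free_cover : Type := {malg R[M]}.
HB.instance Definition _ := GRing.Lmodule.on free_cover.

Definition cover_map : free_cover -> M := @lift R M M id.
HB.instance Definition _ := GRing.Linear.on cover_map.

Definition cover_ker : {pred free_cover} := fun x => cover_map x == 0.

Lemma cover_ker_submod : submod_closed cover_ker.
Proof.
split=> [|a x y]; rewrite !unfold_in /cover_ker ?linear0 ?eqxx //.
move=> /eqP x0 /eqP y0; apply/eqP.
have -> : cover_map (a *: x + y) = a *: cover_map x + cover_map y.
  exact: linearP.
by rewrite x0 y0 scaler0 addr0.
Qed.

HB.instance Definition _ :=
  GRing.isSubmodClosed.Build R free_cover cover_ker cover_ker_submod.

Record syzygy := Syzygy { syz_val : free_cover; _ : syz_val \in cover_ker }.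
HB.instance Definition _ := [isSub for syz_val].
HB.instance Definition _ := [Choice of syzygy by <:].
HB.instance Definition _ := [SubChoice_isSubLmodule of syzygy by <:].

Lemma cover_mapU (m : M) : cover_map << m >> = m.
Proof. exact: liftU. Qed.

Lemma free_projective : projective free_cover.
Proof.
move=> U N g f gsurj.
have [s sE] := boolp.choice (fun m : M => gsurj (f << m >>)).
pose h : {linear free_cover -> U} := lift s.
exists h => x; rewrite /h linear_lift.
rewrite -[x in RHS](lift_basis (x : {malg R[M]})) linear_lift.
exact: eq_lift.
Qed.

End FreeCover.

Section FreeResolution.
Variable M : lmodType R.

Fixpoint iter_syzygy (n : nat) : lmodType R :=
  if n is m.+1 then syzygy (iter_syzygy m) : lmodType R else M.

Definition free_mod (n : nat) : lmodType R := free_cover (iter_syzygy n).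

Definition free_diff (n : nat) : {linear free_mod n.+1 -> free_mod n} :=
  (val : syzygy (iter_syzygy n) -> free_cover (iter_syzygy n)) \o
  @cover_map (syzygy (iter_syzygy n)).

Lemma cover_exact (n : nat) (x : free_mod n) :
  cover_map x = 0 <-> exists y, free_diff n y = x.
Proof.
split=> [x0|[y <-]]; last by apply/eqP; exact: (valP (cover_map y)).
have xK : x \in @cover_ker (iter_syzygy n) by apply/eqP.
pose s : syzygy (iter_syzygy n) := Syzygy xK.
by exists << s >>; rewrite /= cover_mapU.
Qed.

Lemma free_exact (n : nat) (x : free_mod n.+1) :
  free_diff n x = 0 <-> exists y, free_diff n.+1 y = x.
Proof.
rewrite -cover_exact; split=> x0.
  by apply: val_inj; apply: (etrans x0); rewrite raddf0.
rewrite /free_diff /= x0.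
exact: (raddf0 (val : syzygy (iter_syzygy n) -> free_mod n)).
Qed.

Definition free_resolution : resolution M :=
  @Resolution M free_mod free_diff (@cover_map M)
    (fun n => @free_projective (iter_syzygy n))
    (fun m => ex_intro _ << m >> (cover_mapU m))
    (@cover_exact 0) free_exact.

End FreeResolution.
End Resolutions.

Section Ext.
Variables (k : fieldType) (R : algType k) (M N : lmodType R).

(* N as a vector space over k. *)
Local Notation kN := (restr (in_alg R) N).

Section Cochains.
Variable P : resolution M.

Definition cochain (n : nat) : set (res_mod P n -> kN) :=
  [set f | linear (f : res_mod P n -> N)].

Definition cocycle (n : nat) : set (res_mod P n -> kN) :=
  [set f | cochain f /\ forall x, f (res_diff P n x) = 0].

Definition coboundary (n : nat) : set (res_mod P n -> kN) :=
  match n return set (res_mod P n -> kN) with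
  | 0 => [set 0]
  | m.+1 => [set g \o res_diff P m | g in @cochain m]
  end.

End Cochains.

(* Ext^n(M, N) is the n-th cohomology of Hom(P, N), with P the free
   resolution of M. *)
Definition ext_findim (n : nat) : Prop :=
  quot_findim (cocycle (P := free_resolution M) (n := n))
              (coboundary (P := free_resolution M) (n := n)).

Definition ext_dim (n : nat) : nat :=
  quot_dim (cocycle (P := free_resolution M) (n := n))
           (coboundary (P := free_resolution M) (n := n)).

(* The sum over the finite support of the summand; 0 if it is infinite. *)
Definition homological_euler_form : int :=
  \sum_(n \in [set: nat]) (-1) ^+ n * (ext_dim n)%:Z.

End Ext.

Section EulerForms.
Variables (k : fieldType) (Q : quiver).

Definition pa_scalar : {rmorphism k -> path_algebra k Q} := @pa_const k Q.

Definition quiver_dimvec (M : lmodType (path_algebra k Q)) :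
    vertex Q -> nat :=
  fun i => subspace_dim (V := restr pa_scalar M)
    [set vertex_idem k i *: x | x in [set: M]].

Definition quiver_euler_form (d e : vertex Q -> nat) : int :=
  \sum_(i : vertex Q) (d i * e i)%:Z
  - \sum_(a : arrow Q) (d (source a) * e (target a))%:Z.

Variable T : lmodType (path_algebra k Q).

(* kQ[T] *)
Definition path_ope : algType k := @one_point_ext k _ pa_scalar (@pa_const_comm k Q) T.

Definition ope_dimvec (X : lmodType path_ope) : nat * (vertex Q -> nat) :=
  (subspace_dim (V := restr (in_alg path_ope) X)
     [set (ope_pt _ T : path_ope) *: x | x in [set: X]],
   fun i => subspace_dim (V := restr (in_alg path_ope) X)
     [set (ope_A _ T (vertex_idem k i) : path_ope) *: x | x in [set: X]]).

Definition ope_euler_form (x y : nat * (vertex Q -> nat)) : int :=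
  (x.1 * y.1)%:Z - x.1%:Z * quiver_euler_form (quiver_dimvec T) y.2
  + quiver_euler_form x.2 y.2.

End EulerForms.

(* Main.v *)
Require Import Defs.
From mathcomp Require Import all_boot all_order all_algebra.
From mathcomp Require Import finmap zify.
From mathcomp Require Import boolp classical_sets functions fsbigop.
From mathcomp.multinomials Require Import monalg.

Set Implicit Arguments.
Unset Strict Implicit.
Unset Printing Implicit Defensive.

Import GRing.Theory.
Local Open Scope ring_scope.
Local Open Scope classical_set_scope.

(** Write R = kQ[T]: the path algebra of Q enlarged by a vertex w, from which the
elements of T issue like arrows, subject to the relations that an arrow a acts on
t as it does in T. Tensoring over the span of the vertex idempotents gives every
R-module X a standard projective resolution of length 2, with one term for the
vertices, one for the arrows and for T, and one for the relations. Applying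
Hom(-, N) and adjunction turns it into a complex C0(X) -> C1(X) -> C2(X) of spaces
of k-linear maps between the spaces e X, T and e' N, for idempotents e and e'.
For finite-dimensional X its Euler characteristic is read off from the
dimensions: the vertices contribute s s' + sum d_i d'_i, the arrows and the
relations contribute the terms of the Euler forms with a sum over arrows, and T
contributes - s sum t_i d'_i.

It remains to see that this complex computes Ext, which is defined by the
free resolution on all elements. The resolution by the modules R (x) e X is never
built; dimension shifting is used instead. The complex turns a short exact
sequence 0 -> K -> F -> X -> 0 of R-modules into a short exact sequence of
complexes, because the sequence splits over k compatibly with the idempotents
(equivariant_splitting). Its kernel Z0(X) in degree 0 is Hom(X, N), since
idempotents, arrows and T generate R (Z0_linear). On a free module it is exact in
degrees 1 and 2 (free_acyclic1, free_acyclic2), by integration along paths. So the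
connecting maps identify Ext^1(M, N) and Ext^2(M, N) with the cohomology of C(M)
in degrees 1 and 2, and Ext^n(M, N) for n > 2 with the second cohomology of a
syzygy, which vanishes because C2 is right exact (connecting0, connecting1,
ext_dim_ge3). Rank-nullity (three_term_euler) and the count of the dimensions of
C0(M), C1(M) and C2(M) finish the proof.

Dimensions of quotients are compared through linear relations between the spaces
involved (has_quot_dim_corr), so that no quotient space has to be formed. *)

(** * Quotient dimensions *)

Lemma linear_map0 (K : pzRingType) (V W : lmodType K) (f : V -> W) :
  linear f -> f 0 = 0.
Proof.
by move=> f_lin; have := f_lin (-1) 0 0; rewrite !scaleN1r oppr0 addr0 addNr.
Qed.

Lemma linear_mapB (K : pzRingType) (V W : lmodType K) (f : V -> W) x y :
  linear f -> f (x - y) = f x - f y.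
Proof. by move=> f_lin; rewrite addrC -scaleN1r f_lin scaleN1r addrC. Qed.

Section Coordinates.
Variables (k : fieldType).

Definition subsp (V : lmodType k) (U : set V) : Prop :=
  U 0 /\ forall c x y, U x -> U y -> U (c *: x + y).

(** Coordinates on U / W. Unlike bases, they reduce statements on subspaces to
computations with matrices. *)
Definition coordinates (V : lmodType k) (U W : set V) (n : nat)
    (phi : V -> 'rV[k]_n) : Prop :=
  [/\ forall c x y, U x -> U y -> phi (c *: x + y) = c *: phi x + phi y,
      forall c, exists2 x, U x & phi x = c
    & forall x, U x -> (phi x = 0 <-> W x)].

Section Subspaces.
Variable V : lmodType k.
Implicit Types U W : set V.

Lemma subsp0 : subsp [set 0 : V].
Proof. by split=> [|c x y -> ->] //=; rewrite scaler0 addr0. Qed.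

Lemma subspT : subsp [set: V].
Proof. by []. Qed.

Lemma subspB U x y : subsp U -> U x -> U y -> U (x - y).
Proof.
by move=> [_ Ulin] Ux Uy; rewrite addrC -scaleN1r; apply: Ulin.
Qed.

Lemma subspD U x y : subsp U -> U x -> U y -> U (x + y).
Proof. by move=> [_ Ulin] Ux Uy; rewrite -[x]scale1r; apply: Ulin. Qed.

Lemma subspZ U c x : subsp U -> U x -> U (c *: x).
Proof. by move=> [U0 Ulin] Ux; rewrite -[_ *: _]addr0; apply: Ulin. Qed.

Lemma subsp_sum U (I : finType) (F : I -> V) :
  subsp U -> (forall i, U (F i)) -> U (\sum_i F i).
Proof.
move=> sU UF; elim/big_ind: _ => //; first exact: sU.1.
by move=> x y; exact: subspD.
Qed.

End Subspaces.

Lemma subsp_image (V V' : lmodType k) (f : V -> V') (U : set V) :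
  linear f -> subsp U -> subsp (f @` U).
Proof.
move=> f_lin [U0 U_lin]; split=> [|c _ _ [x Ux <-] [y Uy <-]].
  by exists 0 => //; exact: linear_map0.
by exists (c *: x + y); [exact: U_lin | rewrite f_lin].
Qed.

Lemma subsp_kernel (V V' : lmodType k) (f : V -> V') (U : set V) :
  linear f -> subsp U -> subsp [set x | U x /\ f x = 0].
Proof.
move=> f_lin [Uz U_lin]; split=> [|c x y [Ux fx] [Uy fy]].
  by split=> //; exact: linear_map0.
by split; [exact: U_lin | rewrite f_lin fx fy scaler0 addr0].
Qed.

Lemma subsp_row_space n (S : set 'rV[k]_n) : subsp S ->
  exists B : 'M[k]_n, forall v, S v <-> (v <= B)%MS.
Proof.
move=> sS.
pose P r := `[< exists B : 'M[k]_n,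
  \rank B = r /\ forall v : 'rV_n, (v <= B)%MS -> S v >].
have exP : exists r, P r.
  exists 0%N; apply/asboolP; exists 0; rewrite mxrank0; split=> // v.
  by rewrite submx0 => /eqP ->; exact: sS.1.
have ubP r : P r -> (r <= n)%N.
  by move=> /asboolP[B [<- _]]; exact: rank_leq_row.
case: (ex_maxnP exP ubP) => r /asboolP[B [Br BS]] rmax.
exists B => v; split=> [Sv|]; last exact: BS.
have PBv : P (\rank (B + v)%MS).
  apply/asboolP; exists (B + v)%MS; split=> // w.
  move=> /sub_addsmxP[[a b] /= ->]; apply: (subspD sS).
    by apply: BS; exact: submxMl.
  by rewrite [b]mx11_scalar mul_scalar_mx; exact: (subspZ _ sS).
have := rmax _ PBv; rewrite -Br => leB.
apply: submx_trans (addsmxSr B v) _.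
by rewrite -(geq_leqif (mxrank_leqif_sup (addsmxSl B v))).
Qed.

Section OneSpace.
Variable V : lmodType k.
Implicit Types U W : set V.

Lemma coordinates0 U W n (phi : V -> 'rV[k]_n) :
  subsp U -> coordinates U W phi -> phi 0 = 0.
Proof.
move=> [U0 _] [phi_lin _ _]; have := phi_lin (-1) _ _ U0 U0.
by rewrite !scaleN1r oppr0 addr0 addNr.
Qed.

Lemma coordinates_sum U W n (phi : V -> 'rV[k]_n) m (c : 'I_m -> k)
    (e : 'I_m -> V) : subsp U -> coordinates U W phi -> (forall i, U (e i)) ->
  phi (\sum_i c i *: e i) = \sum_i c i *: phi (e i).
Proof.
move=> sU cphi Ue.
suff [] : phi (\sum_i c i *: e i) = \sum_i c i *: phi (e i)
  /\ U (\sum_i c i *: e i) by [].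
elim/big_rec2: _ => [|i x y _ [IH Ux]].
  by split; [exact: coordinates0 sU cphi | exact: sU.1].
by case: (cphi) => phi_lin _ _; rewrite phi_lin // IH; split=> //; apply: sU.2.
Qed.

Lemma has_quot_dimP U W n : subsp U -> subsp W ->
  has_quot_dim U W n <-> exists phi : V -> 'rV[k]_n, coordinates U W phi.
Proof.
move=> sU sW; split=> [[e [Ue eP]]|[phi cphi]].
  pose rel v (c : 'rV_n) := W (v - \sum_(i < n) c 0 i *: e i).
  have ex v : exists c, U v -> rel v c.
    have [Uv|nUv] := pselect (U v); last by exists 0.
    by have [c [vc _]] := eP v Uv; exists c.
  have [phi phiP] := choice ex; exists phi.
  have phiE v c : U v -> rel v c -> phi v = c.
    move=> Uv vc; have [c' [_ c'U]] := eP v Uv.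
    by rewrite -(c'U c) // -(c'U (phi v)) //; exact: phiP.
  split=> [c x y Ux Uy|c|x Ux].
  - apply: phiE; first exact: sU.2.
    rewrite /rel (_ : _ - _ =
      c *: (x - \sum_(i < n) phi x 0 i *: e i)
        + (y - \sum_(i < n) phi y 0 i *: e i)); last first.
      rewrite scalerBr addrACA -opprD; congr (_ - _).
      rewrite scaler_sumr -big_split; apply: eq_bigr => i _ /=.
      by rewrite !mxE scalerDl scalerA.
    by apply: sW.2; exact: phiP.
  - exists (\sum_(i < n) c 0 i *: e i).
      by apply: subsp_sum => // i; exact: subspZ.
    apply: phiE; first by apply: subsp_sum => // i; exact: subspZ.
    by rewrite /rel subrr; exact: sW.1.
  - have sum0 : \sum_(i < n) (0 : 'rV[k]_n) 0 i *: e i = 0.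
      by rewrite big1 // => i _; rewrite mxE scale0r.
    split=> [x0|Wx]; first by have := phiP x Ux; rewrite /rel x0 sum0 subr0.
    by apply: phiE => //; rewrite /rel sum0 subr0.
have [phi_lin phi_surj phi_ker] := cphi.
have /choice [e eP] (i : 'I_n) : exists x, U x /\ phi x = delta_mx 0 i.
  by have [x Ux xi] := phi_surj (delta_mx 0 i); exists x.
have Ue i : U (e i) by have [] := eP i.
have phie (c : 'rV_n) : phi (\sum_(i < n) c 0 i *: e i) = c.
  rewrite (coordinates_sum _ sU cphi) // [RHS]row_sum_delta.
  by apply: eq_bigr => i _; have [_ ->] := eP i.
have Uc (c : 'rV_n) : U (\sum_(i < n) c 0 i *: e i).
  by apply: subsp_sum => // i; exact: subspZ.
exists e; split=> // v Uv.
have phiB (c : 'rV_n) : phi (v - \sum_(i < n) c 0 i *: e i) = phi v - c.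
  by rewrite addrC -scaleN1r phi_lin // phie scaleN1r addrC.
exists (phi v); split=> [|c vc].
  by apply/phi_ker; [exact: subspB | rewrite phiB subrr].
by apply/eqP; rewrite -subr_eq0 -phiB; apply/eqP/phi_ker; first exact: subspB.
Qed.

Lemma quot_dim_leq U W n m : subsp U -> subsp W ->
  has_quot_dim U W n -> has_quot_dim U W m -> (n <= m)%N.
Proof.
move=> sU sW /(has_quot_dimP _ sU sW)[phi cphi] /(has_quot_dimP _ sU sW)[psi cpsi].
have [_ phi_surj phi_ker] := cphi; have [_ _ psi_ker] := cpsi.
have /choice [e eP] (i : 'I_n) : exists x, U x /\ phi x = delta_mx 0 i.
  by have [x Ux xi] := phi_surj (delta_mx 0 i); exists x.
have Ue i : U (e i) by have [] := eP i.
pose A : 'M[k]_(n, m) := \matrix_(i, j) psi (e i) 0 j.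
have : row_free A.
  apply: inj_row_free => c cA0.
  have c0 : psi (\sum_(i < n) c 0 i *: e i) = 0.
    rewrite (coordinates_sum _ sU cpsi) // -[RHS]cA0 mulmx_sum_row.
    by apply: eq_bigr => i _; congr (_ *: _); apply/rowP => j; rewrite !mxE.
  have Uc : U (\sum_(i < n) c 0 i *: e i).
    by apply: subsp_sum => // i; exact: subspZ.
  have /(phi_ker _ Uc) := (psi_ker _ Uc).1 c0.
  rewrite (coordinates_sum _ sU cphi) // => <-; rewrite [LHS]row_sum_delta.
  by apply: eq_bigr => i _; have [_ ->] := eP i.
by move=> /eqP <-; exact: rank_leq_col.
Qed.

Lemma quot_dimE U W n : subsp U -> subsp W ->
  has_quot_dim U W n -> quot_dim U W = n.
Proof.
move=> sU sW Un; have Um : has_quot_dim U W (quot_dim U W).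
  exact: (@xgetPex _ 0%N [set n | has_quot_dim U W n] (ex_intro _ n Un)).
by apply/eqP; rewrite eqn_leq !(@quot_dim_leq U W).
Qed.

Lemma quot_dim_add U W Z m n : subsp U -> subsp W -> subsp Z ->
  Z `<=` W -> W `<=` U ->
  has_quot_dim U W m -> has_quot_dim W Z n -> has_quot_dim U Z (m + n).
Proof.
move=> sU sW sZ ZW WU [e [Ue eP]] /(has_quot_dimP _ sW sZ)[psi cpsi].
have /(has_quot_dimP _ sU sW)[phi cphi] : has_quot_dim U W m by exists e.
have [phi_lin phi_surj phi_ker] := cphi; have [psi_lin psi_surj psi_ker] := cpsi.
have /choice [d dP] (i : 'I_m) : exists x, U x /\ phi x = delta_mx 0 i.
  by have [x Ux xi] := phi_surj (delta_mx 0 i); exists x.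
have Ud i : U (d i) by have [] := dP i.
pose low x := \sum_(i < m) phi x 0 i *: d i.
have Ulow x : U (low x) by apply: subsp_sum => // i; exact: subspZ.
have phi_low x : phi (low x) = phi x.
  rewrite (coordinates_sum _ sU cphi) // [RHS]row_sum_delta.
  by apply: eq_bigr => i _; have [_ ->] := dP i.
have Wlow x : U x -> W (x - low x).
  move=> Ux; apply/phi_ker; first exact: subspB.
  by rewrite addrC -scaleN1r phi_lin // phi_low scaleN1r addNr.
have low_lin c x y : U x -> U y -> low (c *: x + y) = c *: low x + low y.
  move=> Ux Uy; rewrite /low scaler_sumr -big_split; apply: eq_bigr => i _ /=.
  by rewrite phi_lin // !mxE scalerDl scalerA.
apply/has_quot_dimP => //; exists (fun x => row_mx (phi x) (psi (x - low x))).
split=> [c x y Ux Uy|c|x Ux].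
- rewrite phi_lin // low_lin // opprD addrACA -scalerBr psi_lin; try exact: Wlow.
  by rewrite scale_row_mx add_row_mx.
- have [x Ux xc] := phi_surj (lsubmx c).
  have [y Wy yc] := psi_surj (rsubmx c - psi (x - low x)).
  have phiy : phi y = 0 by apply/phi_ker => //; exact: WU.
  have phixy : phi (x + y) = phi x.
    by have := phi_lin 1 x y Ux (WU _ Wy); rewrite !scale1r phiy addr0.
  exists (x + y); first by apply: subspD => //; exact: WU.
  have -> : low (x + y) = low x by rewrite /low phixy.
  have := psi_lin 1 y (x - low x) Wy (Wlow _ Ux).
  rewrite !scale1r yc subrK addrA [y + x]addrC phixy xc => ->.
  by rewrite hsubmxK.
- split=> [|Zx].
    move=> /(congr1 (fun u => (lsubmx u, rsubmx u))).
    rewrite row_mxKl row_mxKr !linear0 => -[x0].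
    have -> : low x = 0 by rewrite /low x0 big1 // => i _; rewrite mxE scale0r.
    by rewrite subr0 psi_ker //; apply/phi_ker.
  have x0 : phi x = 0 by apply/phi_ker => //; exact: ZW.
  have -> : low x = 0 by rewrite /low x0 big1 // => i _; rewrite mxE scale0r.
  have -> : psi (x - 0) = 0 by rewrite subr0; apply/psi_ker => //; exact: ZW.
  by rewrite x0 row_mx0.
Qed.

(** Passing to coordinates turns W into a row space, where Gaussian elimination
provides a basis and a complement. *)
Lemma quot_findim_split U W Z n : subsp U -> subsp W -> subsp Z ->
  Z `<=` W -> W `<=` U -> has_quot_dim U Z n ->
  quot_findim U W /\ quot_findim W Z.
Proof.
move=> sU sW sZ ZW WU /(has_quot_dimP _ sU sZ)[phi cphi].
have [phi_lin phi_surj phi_ker] := cphi.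
have phiB x y : U x -> U y -> phi (x - y) = phi x - phi y.
  by move=> Ux Uy; rewrite addrC -scaleN1r phi_lin // scaleN1r addrC.
have [|B BE] := @subsp_row_space n (phi @` W).
  split=> [|c _ _ [x Wx <-] [y Wy <-]].
    by exists 0; [exact: sW.1 | exact: coordinates0 sU cphi].
  by exists (c *: x + y); [exact: sW.2 | rewrite phi_lin //; exact: WU].
have WB x : U x -> (phi x <= B)%MS <-> W x.
  move=> Ux; split=> [/BE[y Wy xy]|Wx]; last by apply/BE; exists x.
  rewrite -(subrK y x); apply: subspD => //; apply: ZW.
  have Uy := WU _ Wy.
  by apply/phi_ker; [exact: subspB | rewrite phiB // xy subrr].
split.
  exists (\rank (cokermx B)); apply/has_quot_dimP => //.
  exists (fun x => phi x *m col_base (cokermx B)); split=> [c x y Ux Uy|c|x Ux].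
  - by rewrite phi_lin // mulmxDl scalemxAl.
  - have [x Ux xE] := phi_surj (c *m pinvmx (col_base (cokermx B))).
    exists x => //; rewrite xE mulmxKpV //.
    exact/submx_full/col_base_full.
  - have cE : phi x *m cokermx B =
        phi x *m col_base (cokermx B) *m row_base (cokermx B).
      by rewrite -mulmxA mulmx_base.
    rewrite -WB // submxE cE; split=> [->|/eqP x0]; first by rewrite mul0mx.
    have /row_free_inj inj := row_base_free (cokermx B).
    by apply: inj; rewrite x0 mul0mx.
exists (\rank B); apply/has_quot_dimP => //.
exists (fun x => phi x *m pinvmx (row_base B)); split=> [c x y Wx Wy|c|x Wx].
- by rewrite phi_lin ?mulmxDl ?scalemxAl //; exact: WU.
- have /BE[x Wx xE] : (c *m row_base B <= B)%MS.
    by rewrite -(eq_row_base B); exact: submxMl.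
  by exists x => //; rewrite xE mulmxKp // row_base_free.
- have xB : (phi x <= row_base B)%MS.
    by rewrite eq_row_base; apply/WB => //; exact: WU.
  rewrite -phi_ker; last exact: WU.
  split=> [x0|->]; last by rewrite mul0mx.
  by rewrite -(mulmxKpV xB) x0 mul0mx.
Qed.

Lemma has_quot_dim0 U W : subsp U -> (forall x, U x -> W x) -> subsp W ->
  has_quot_dim U W 0.
Proof.
move=> sU UW sW; apply/has_quot_dimP => //; exists (fun=> 0).
split=> [c x y _ _|c|x /UW]; first by rewrite scaler0 addr0.
  by exists 0; [exact: sU.1 | rewrite [c]thinmx0].
by [].
Qed.

End OneSpace.

(** The relational form of an isomorphism from U / W to U' / W'. It spares the
choice of representatives in a diagram chase. *)
Definition quot_corr (V V' : lmodType k) (U W : set V) (U' W' : set V')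
    (rho : V -> V' -> Prop) : Prop :=
  [/\ forall c x x' y y', rho x x' -> rho y y' ->
        rho (c *: x + y) (c *: x' + y'),
      forall x, U x -> exists2 x', U' x' & rho x x',
      forall x', U' x' -> exists2 x, U x & rho x x'
    & forall x x', U x -> U' x' -> rho x x' -> (W x <-> W' x')].

Lemma has_quot_dim_corr (V V' : lmodType k) (U W : set V) (U' W' : set V')
    (rho : V -> V' -> Prop) n :
  subsp U -> subsp W -> subsp U' -> subsp W' ->
  quot_corr U W U' W' rho ->
  has_quot_dim U W n -> has_quot_dim U' W' n.
Proof.
move=> sU sW sU' sW' [rho_lin tot surj same].
move=> /(has_quot_dimP _ sU sW)[phi [phi_lin phi_surj phi_ker]].
have /choice [g gP] x' : exists x, U' x' -> U x /\ rho x x'.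
  have [/surj[x Ux xx']|nUx'] := pselect (U' x'); last by exists 0.
  by exists x.
have phi_eq x y x' : U x -> U y -> U' x' -> rho x x' -> rho y x' ->
    phi x = phi y.
  move=> Ux Uy Ux' xx' yx'; apply/eqP; rewrite -subr_eq0; apply/eqP.
  rewrite addrC -scaleN1r -phi_lin //; apply/phi_ker; first exact: sU.2.
  apply/(same _ (-1 *: x' + x')); [exact: sU.2|exact: sU'.2|exact: rho_lin|].
  by rewrite scaleN1r addNr; exact: sW'.1.
apply/has_quot_dimP => //; exists (phi \o g).
split=> [c x' y' Ux' Uy'|c|x' Ux'] /=.
- have [Ux xx'] := gP _ Ux'; have [Uy yy'] := gP _ Uy'.
  have Uxy' : U' (c *: x' + y') by exact: sU'.2.
  have [Uxy xyxy'] := gP _ Uxy'.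
  rewrite -phi_lin //; apply: phi_eq Uxy' xyxy' _ => //; first exact: sU.2.
  exact: rho_lin.
- have [x Ux <-] := phi_surj c; have [x' Ux' xx'] := tot _ Ux.
  have [Ugx gxx'] := gP _ Ux'.
  by exists x' => //; exact: (phi_eq _ _ x').
- have [Ugx gxx'] := gP _ Ux'.
  by rewrite phi_ker //; exact: same.
Qed.

Lemma has_dim_image (V V' : lmodType k) (U : set V) (f : V -> V') n :
  linear f -> subsp U -> has_quot_dim U [set x | U x /\ f x = 0] n ->
  has_quot_dim (f @` U) [set 0] n.
Proof.
move=> f_lin sU; apply: (has_quot_dim_corr (rho := fun x y => U x /\ f x = y)).
- exact: sU.
- exact: subsp_kernel.
- exact: subsp_image.
- exact: subsp0.
- split=> [c x x' y y' [Ux <-] [Uy <-]|x Ux|_ [x Ux <-]|x x' Ux _ [_ <-]].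
  + by split; [exact: sU.2 | rewrite f_lin].
  + by exists (f x) => //; exists x.
  + by exists x.
  + by split=> [[]|].
Qed.

Lemma quot_corr_sym (V V' : lmodType k) (U W : set V) (U' W' : set V')
    (rho : V -> V' -> Prop) :
  quot_corr U W U' W' rho -> quot_corr U' W' U W (fun x' x => rho x x').
Proof.
move=> [rho_lin tot surj same]; split=> //.
- by move=> c x x' y y'; exact: rho_lin.
- by move=> x x' Ux Ux' xx'; apply: iff_sym; exact: same.
Qed.

End Coordinates.

(** * Spaces of linear maps *)

Section FunctionSpaces.
Variables (k : fieldType).

Lemma has_dim_pair (V V' : lmodType k) (U : set V) (U' : set V') m n :
  subsp U -> subsp U' -> has_quot_dim U [set 0] m ->
  has_quot_dim U' [set 0] n ->
  has_quot_dim [set x : V * V' | U x.1 /\ U' x.2] [set 0] (m + n).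
Proof.
move=> sU sU' /(has_quot_dimP _ sU (@subsp0 _ _))[phi [phi_lin phi_surj phi_ker]].
move=> /(has_quot_dimP _ sU' (@subsp0 _ _))[psi [psi_lin psi_surj psi_ker]].
apply/has_quot_dimP; last 2 first.
- exact: subsp0.
- exists (fun x => row_mx (phi x.1) (psi x.2)); split.
  + move=> c x y [Ux Ux'] [Uy Uy']; rewrite phi_lin // psi_lin //.
    by rewrite scale_row_mx add_row_mx.
  + move=> c; have [x Ux xE] := phi_surj (lsubmx c).
    have [y Uy yE] := psi_surj (rsubmx c).
    by exists (x, y) => //=; rewrite xE yE hsubmxK.
  + move=> [x y] /= [Ux Uy]; split=> [|[-> ->]]; last first.
      by rewrite (phi_ker _ sU.1).2 // (psi_ker _ sU'.1).2 // row_mx0.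
    move=> /(congr1 (fun u => (lsubmx u, rsubmx u))).
    by rewrite row_mxKl row_mxKr !linear0 => -[/(phi_ker _ Ux) -> /(psi_ker _ Uy) ->].
- split=> [|c x y [Ux Ux'] [Uy Uy']]; first by split; [exact: sU.1 | exact: sU'.1].
  by split; [exact: sU.2 | exact: sU'.2].
Qed.

Lemma subsp_family (I : Type) (V : lmodType k) (U : I -> set V) :
  (forall i, subsp (U i)) -> subsp [set f : I -> V | forall i, U i (f i)].
Proof.
move=> sU; split=> [i|c f g Uf Ug i]; first exact: (sU i).1.
exact: (sU i).2.
Qed.

Lemma has_dim_family (I : finType) (V : lmodType k) (U : I -> set V)
    (n : I -> nat) :
  (forall i, subsp (U i)) -> (forall i, has_quot_dim (U i) [set 0] (n i)) ->
  has_quot_dim [set f : I -> V | forall i, U i (f i)] [set 0] (\sum_i n i).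
Proof.
move=> sU dU.
have ex i := (has_quot_dimP (n i) (sU i) (@subsp0 k V)).1 (dU i).
pose phi i := projT1 (cid (ex i)).
have phiP i : coordinates (U i) [set 0] (phi i) := projT2 (cid (ex i)).
pose J : finType := {i : I & 'I_(n i)}.
have <- : #|J| = (\sum_i n i)%N.
  by rewrite card_tagged sumnE big_map big_enum; under eq_bigr do rewrite card_ord.
apply/has_quot_dimP; [exact: subsp_family | exact: subsp0 |].
exists (fun f => \row_(j < #|J|)
  phi (tag (enum_val j)) (f (tag (enum_val j))) 0 (tagged (enum_val j))).
split=> [c f g Uf Ug|c|f Uf].
- apply/rowP => j; rewrite !mxE; have [phi_lin _ _] := phiP (tag (enum_val j)).
  have -> : (c *: f + g) (tag (enum_val j)) =
    c *: f (tag (enum_val j)) + g (tag (enum_val j)) by [].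
  by rewrite phi_lin // !mxE.
- have /choice [f fP] i : exists x, U i x /\ phi i x =
      \row_(l < n i) c 0 (enum_rank (Tagged (fun i => 'I_(n i)) l)).
    have [_ phi_surj _] := phiP i.
    by have [x Ux xE] := phi_surj
      (\row_(l < n i) c 0 (enum_rank (Tagged (fun i => 'I_(n i)) l))); exists x.
  exists f; first by move=> i; have [] := fP i.
  apply/rowP => j; rewrite mxE (fP _).2 mxE; congr (c 0 _).
  by rewrite -[RHS]enum_valK; case: (enum_val j).
- split=> [f0|->]; last first.
    apply/rowP => j; rewrite !mxE.
    by rewrite (coordinates0 (sU _) (phiP _)) mxE.
  apply: funext => i; have [_ _ phi_ker] := phiP i.
  apply/(phi_ker _ (Uf i)); apply/rowP => l; rewrite !mxE.
  have /rowP/(_ (enum_rank (Tagged (fun i => 'I_(n i)) l))) := f0.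
  by rewrite !mxE enum_rankK.
Qed.

(** For an idempotent p this is Hom(p X, U), realized among the functions on X
so that all cochain spaces live in function spaces. *)
Definition khom (X Y : lmodType k) (p : X -> X) (U : set Y) : set (X -> Y) :=
  [set f | [/\ linear f, forall x, f (p x) = f x & forall x, U (f x)]].

Lemma subsp_khom (X Y : lmodType k) (p : X -> X) (U : set Y) :
  subsp U -> subsp (khom p U).
Proof.
move=> sU; split.
  by split=> // [c x y|x]; [rewrite scaler0 addr0 | exact: sU.1].
move=> c f g [f_lin fp Uf] [g_lin gp Ug]; split=> [a x y|x|x].
- have E z : (c *: f + g) z = c *: f z + g z by [].
  rewrite !E f_lin g_lin !scalerDr !scalerA addrACA; congr (_ + _ + _).
  by rewrite mulrC.
- by rewrite -[RHS]/(c *: f x + g x) -fp -gp.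
- exact: sU.2.
Qed.

Lemma khom_sum (X Y : lmodType k) (f : X -> Y) n (c : 'I_n -> k) (e : 'I_n -> X) :
  linear f -> f (\sum_i c i *: e i) = \sum_i c i *: f (e i).
Proof.
move=> f_lin; have f0 := linear_map0 f_lin.
by elim/big_rec2: _ => // i x y _ <-; exact: f_lin.
Qed.

(** Evaluation on a basis of p X identifies the maps with m-tuples in U. *)
Lemma has_dim_khom (X Y : lmodType k) (p : X -> X) (U : set Y) m n :
  linear p -> (forall x, p (p x) = p x) -> subsp U ->
  has_quot_dim (range p) [set 0] m -> has_quot_dim U [set 0] n ->
  has_quot_dim (khom p U) [set 0] (m * n).
Proof.
move=> p_lin pp sU pm Un.
have sp : subsp (range p) := subsp_image p_lin (@subspT k X).
have := has_dim_family (fun _ : 'I_m => sU) (fun=> Un).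
rewrite sum_nat_const card_ord => fam.
have [b [bp bP]] := pm; have pb i : p (b i) = b i by have [x _ <-] := bp i.
have ex x : exists c : 'rV[k]_m, p x = \sum_i c 0 i *: b i.
  have [|c [/= /eqP + _]] := bP (p x); first by exists x.
  by rewrite subr_eq0 => /eqP ->; exists c.
have [cf cfE] := choice ex.
have uniq_c (c c' : 'rV[k]_m) :
    \sum_i c 0 i *: b i = \sum_i c' 0 i *: b i -> c = c'.
  move=> cc'; have [|d [_ dU]] := bP (\sum_i c 0 i *: b i).
    by apply: subsp_sum => // i; apply: subspZ.
  by rewrite -(dU c) ?(dU c') //= ?cc' subrr.
have sF : subsp [set f : 'I_m -> Y | forall i, U (f i)].
  exact: (subsp_family (fun=> sU)).
apply: (has_quot_dim_corr (rho := fun (c : 'I_m -> Y) (f : X -> Y) =>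
    forall i, f (b i) = c i)) sF (@subsp0 _ _) _ (@subsp0 _ _) _ fam.
  exact: subsp_khom.
split=> [a c f c' f' cf' cf'' i|c Uc|f [f_lin fp Uf]|c f Uc [f_lin fp Uf] fc].
- by rewrite -[LHS]/(a *: f (b i) + f' (b i)) cf' cf''.
- exists (fun x => \sum_i cf x 0 i *: c i); last first.
    move=> i; have -> : cf (b i) = delta_mx 0 i.
      apply: uniq_c; rewrite -cfE pb (bigD1 i) //= mxE !eqxx scale1r big1 ?addr0 //.
      by move=> j ji; rewrite mxE (negPf ji) scale0r.
    rewrite (bigD1 i) //= mxE !eqxx scale1r big1 ?addr0 //.
    by move=> j ji; rewrite mxE (negPf ji) scale0r.
  split=> [a x y|x|x].
  + have -> : cf (a *: x + y) = a *: cf x + cf y.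
      apply: uniq_c; rewrite -cfE p_lin !cfE scaler_sumr -big_split.
      by apply: eq_bigr => i _; rewrite !mxE scalerDl scalerA.
    rewrite scaler_sumr -big_split; apply: eq_bigr => i _ /=.
    by rewrite !mxE scalerDl scalerA.
  + by have -> : cf (p x) = cf x by apply: uniq_c; rewrite -!cfE pp.
  + by apply: subsp_sum => // i; exact: subspZ.
- by exists (fun i => f (b i)) => //= i; exact: Uf.
- split=> [c0|f0].
    apply: funext => x; rewrite -fp cfE khom_sum // big1 // => i _.
    by rewrite fc c0 scaler0.
  by apply: funext => i; rewrite -fc f0.
Qed.

(** Every subspace has a complement, by Zorn's lemma. *)
Lemma linear_retraction (V K : lmodType k) (i : K -> V) :
  linear i -> injective i -> exists s : V -> K, linear s /\ forall x, s (i x) = x.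
Proof.
move=> i_lin i_inj.
have i0 := linear_map0 i_lin.
have iZ c x : i (c *: x) = c *: i x.
  by have := i_lin c x 0; rewrite i0 !addr0.
(* subspaces meeting the image of i trivially; the disjunct keeps the union
   of the empty chain *)
pose P (C : set V) := C = set0 \/ (subsp C /\ forall x, C (i x) -> x = 0).
have [F FP Ftot|C [PC Cmax]] := @Zorn_bigcup V P.
  have [[D [FD [d Dd]]]|none] := pselect (exists D, F D /\ exists d, D d); last first.
    left; apply/seteqP; split=> // x [D FD Dx]; apply: none; exists D.
    by split=> //; exists x.
  right; have sF E x : F E -> E x -> subsp E /\ forall x, E (i x) -> x = 0.
    by move=> FE Ex; have [E0|//] := FP _ FE; move: Ex; rewrite E0.
  split; last by move=> x [E FE Ex]; exact: (sF _ _ FE Ex).2.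
  split=> [|c x y [E FE Ex] [E' FE' Ey]].
    by exists D => //; exact: (sF _ _ FD Dd).1.1.
  have [EE'|E'E] := Ftot _ _ FE FE'.
    by exists E' => //; apply: (sF _ _ FE' Ey).1.2 => //; exact: EE'.
  by exists E => //; apply: (sF _ _ FE Ex).1.2 => //; exact: E'E.
have {PC} [sC C0] : subsp C /\ forall x, C (i x) -> x = 0.
  have [C0|//] := PC; exfalso.
  apply: (Cmax [set 0]); last by right; split; [exact: subsp0|];
    move=> x /= ix0; apply: i_inj; rewrite i0.
  by rewrite C0; split=> // /(_ 0 erefl).
have dec v : exists x, C (v - i x).
  have [//|nv] := pselect (exists x, C (v - i x)); exfalso.
  apply: (Cmax [set w | exists a, C (w - a *: v)]).
    split=> [w Cw|CC]; first by exists 0; rewrite scale0r subr0.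
    apply: nv; exists 0; rewrite i0 subr0; apply: CC.
    by exists 1; rewrite scale1r subrr; exact: sC.1.
  right; split=> [|x [a xa]].
    split; first by exists 0; rewrite scale0r subr0; exact: sC.1.
    move=> c x y [a xa] [b yb]; exists (c * a + b).
    rewrite scalerDl opprD addrACA -scalerA -scalerBr.
    exact: sC.2.
  have [a0|a0] := eqVneq a 0.
    by apply: C0; move: xa; rewrite a0 scale0r subr0.
  exfalso; apply: nv; exists (a^-1 *: x); rewrite iZ.
  rewrite -[v in v - _](scalerK a0) -scalerBr -opprB scalerN -scaleNr.
  exact: subspZ.
have [s sP] := choice dec; exists s.
have s_eq v x : C (v - i x) -> s v = x.
  move=> vx; apply/eqP; rewrite -subr_eq0; apply/eqP/C0.
  have -> : i (s v - x) = (v - i x) - (v - i (s v)).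
    by rewrite (linear_mapB _ _ i_lin) opprB [RHS]addrC addrA subrK.
  exact: subspB.
split=> [c x y|x]; apply: s_eq; last by rewrite subrr; exact: sC.1.
rewrite i_lin opprD addrACA -scalerBr.
exact: sC.2.
Qed.

End FunctionSpaces.

(** * The connecting map *)

Section Connecting.
Variables (k : fieldType) (VF VK VX WF WK WX : lmodType k).
Variables (AF : set VF) (AK : set VK) (AX : set VX) (ZF : set WF) (ZX : set WX).
Variables (pA : VX -> VF) (rA : VF -> VK) (pB : WX -> WF) (rB : WF -> WK).
Variables (dF : VF -> WF) (dK : VK -> WK) (dX : VX -> WX).
Hypothesis rA_lin : linear rA.
Hypothesis dF_lin : linear dF.
Hypothesis pB_lin : linear pB.
Hypothesis sAF : subsp AF.
Hypothesis pA_in : forall g, AX g -> AF (pA g).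
Hypothesis rA_in : forall f, AF f -> AK (rA f).
Hypothesis rA_onto : forall f, AK f -> exists2 f', AF f' & rA f' = f.
Hypothesis rpA : forall g, AX g -> rA (pA g) = 0.
Hypothesis kerA : forall f, AF f -> rA f = 0 -> exists2 g, AX g & pA g = f.
Hypothesis pB_inj : forall u v, pB u = pB v -> u = v.
Hypothesis rpB : forall u, ZX u -> rB (pB u) = 0.
Hypothesis pB_in : forall u, ZX u -> ZF (pB u).
Hypothesis kerB : forall u, ZF u -> rB u = 0 -> exists2 v, ZX v & pB v = u.
Hypothesis dF_in : forall f, AF f -> ZF (dF f).
Hypothesis dF_onto : forall u, ZF u -> exists2 f, AF f & dF f = u.
Hypothesis dpA : forall g, AX g -> dF (pA g) = pB (dX g).
Hypothesis drA : forall f, AF f -> dK (rA f) = rB (dF f).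

(** The snake lemma in the case where the middle column is exact at ZF: a
cocycle on K is lifted to F, and the differential of the lift descends to X. *)
Lemma connecting_corr :
  quot_corr [set f | AK f /\ dK f = 0] (rA @` [set f | AF f /\ dF f = 0])
    ZX (dX @` AX)
    (fun f u => exists f', [/\ AF f', rA f' = f & dF f' = pB u]).
Proof.
split=> [c f u g v [f' [Af <- df]] [g' [Ag <- dg]]|f [Kf df]|u Zu|f u [Kf df] Zu].
- exists (c *: f' + g'); split; first exact: sAF.2.
    by rewrite rA_lin.
  by rewrite dF_lin df dg pB_lin.
- have [f' Ff' rf'] := rA_onto Kf.
  have [|u Zu uE] := kerB (dF_in Ff'); first by rewrite -drA // rf'.
  by exists u => //; exists f'.
- have [f' Ff' df'] := dF_onto (pB_in Zu).
  exists (rA f'); last by exists f'.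
  by split; [exact: rA_in | rewrite drA // df' rpB].
- have rA_B x y : rA (x - y) = rA x - rA y by exact: linear_mapB.
  have dF_B x y : dF (x - y) = dF x - dF y by exact: linear_mapB.
  move=> [f' [Af rf df']]; split=> [[g [Ag dg] gf]|[g Ag gu]].
    have [||h Ah hE] := @kerA (f' - g); first exact: subspB.
      by rewrite rA_B rf gf subrr.
    exists h => //; apply: pB_inj.
    by rewrite -dpA // hE dF_B df' dg subr0.
  exists (f' - pA g); last by rewrite rA_B rf rpA // subr0.
  split; first by apply: subspB => //; exact: pA_in.
  by rewrite dF_B df' dpA // gu subrr.
Qed.

End Connecting.

(** * The standard complex *)

Lemma addr_shuffle (Z : zmodType) (x1 x2 y1 y2 z1 z2 : Z) :
  (x1 + x2) - (y1 + y2) + (z1 + z2) = (x1 - y1 + z1) + (x2 - y2 + z2).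
Proof. by rewrite opprD (addrACA x1) (addrACA (x1 - y1)). Qed.

(** The algebra kQ[T] is the path algebra of Q enlarged by a vertex fpt, from
which the elements of the vector space fspace = T issue in place of arrows, with
the relations that arrows act on them as on T. All that the complex below needs
of kQ[T] is recorded here. *)
Record frame (k : fieldType) (R : algType k) := Frame {
  fvertex : finType;
  farrow : finType;
  fsrc : farrow -> fvertex;
  ftgt : farrow -> fvertex;
  fpt : fvertex;
  fspace : lmodType k;
  fidem : fvertex -> R;
  farr : farrow -> R;
  femb : fspace -> R;
  fidemT : fvertex -> fspace -> fspace;
  farrT : farrow -> fspace -> fspace;
  fidem_mul : forall u v, fidem u * fidem v = if u == v then fidem v else 0;
  fidem_sum : \sum_v fidem v = 1;
  farr_tgt : forall a, fidem (ftgt a) * farr a = farr a;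
  farr_src : forall a, farr a * fidem (fsrc a) = farr a;
  femb_lin : linear femb;
  femb_pt : forall t, femb t * fidem fpt = femb t;
  femb_idem : forall v t, femb (fidemT v t) = fidem v * femb t;
  femb_arr : forall a t, femb (farrT a t) = farr a * femb t;
  fidemT_lin : forall v, linear (fidemT v);
  farrT_lin : forall a, linear (farrT a);
  fidemT_mul : forall u v t,
    fidemT u (fidemT v t) = if u == v then fidemT v t else 0;
  fidemT_sum : forall t, \sum_v fidemT v t = t;
  farrT_tgt : forall a t, fidemT (ftgt a) (farrT a t) = farrT a t;
  farrT_src : forall a t, farrT a (fidemT (fsrc a) t) = farrT a t }.

Section Complex.
Variables (k : fieldType) (R : algType k) (S : frame R) (N : lmodType R).
Local Notation V := (fvertex S).
Local Notation J := (farrow S).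
Local Notation T := (fspace S).
Local Notation E := (@fidem _ _ S).
Local Notation Ar := (@farr _ _ S).
Local Notation tt := (@femb _ _ S).
Local Notation eT := (@fidemT _ _ S).
Local Notation aT := (@farrT _ _ S).
Local Notation w := (fpt S).
Local Notation kmod X := (restr (in_alg R) X).
Local Notation kN := (kmod N).

Definition klin (X Y : lmodType R) (f : X -> Y) : Prop :=
  forall c x y, f (c%:A *: x + y) = c%:A *: f x + f y.

Definition kbilin (X : lmodType R) (h : X -> T -> N) : Prop :=
  (forall t, klin (h^~ t)) /\
  forall x c t u, h x (c *: t + u) = c%:A *: h x t + h x u.

Section Klin.
Variables (X Y : lmodType R) (f : X -> Y).
Hypothesis fk : klin f.

Lemma klinD x y : f (x + y) = f x + f y.
Proof. by have := fk 1 x y; rewrite !scale1r. Qed.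

Lemma klin0 : f 0 = 0.
Proof. by apply: (addIr (f 0)); rewrite -klinD !add0r. Qed.

Lemma klinZ c x : f (c%:A *: x) = c%:A *: f x.
Proof. by have := fk c x 0; rewrite klin0 !addr0. Qed.

Lemma klinN x : f (- x) = - f x.
Proof. by apply: (addIr (f x)); rewrite -klinD !addNr klin0. Qed.

Lemma klinB x y : f (x - y) = f x - f y.
Proof. by rewrite klinD klinN. Qed.

Lemma klin_sum (I : Type) (r : seq I) (P : pred I) (F : I -> X) :
  f (\sum_(i <- r | P i) F i) = \sum_(i <- r | P i) f (F i).
Proof. by elim/big_rec2: _ => [|i y1 y2 _ <-]; rewrite ?klin0 ?klinD. Qed.

End Klin.

Lemma scalar_commute (X : lmodType R) c (r : R) (x : X) :
  c%:A *: (r *: x) = r *: (c%:A *: x).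
Proof. by rewrite !scalerA -scalerAl mul1r -scalerAr mulr1. Qed.

Lemma klin_scale (X : lmodType R) (r : R) : klin (fun x : X => r *: x).
Proof. by move=> c x y; rewrite scalerDr -scalar_commute. Qed.

Lemma klin_comp (X Y Z : lmodType R) (f : Y -> Z) (g : X -> Y) :
  klin f -> klin g -> klin (fun x => f (g x)).
Proof. by move=> fk gk c x y; rewrite gk fk. Qed.

Lemma linear_klin (X Y : lmodType R) (f : {linear X -> Y}) : klin f.
Proof. by move=> c x y; rewrite linearP. Qed.

Lemma klin_lincomb (X Y : lmodType R) (f g : X -> Y) a :
  klin f -> klin g -> klin (fun x => a%:A *: f x + g x).
Proof.
move=> fk gk c x y; rewrite fk gk !scalerDr addrACA; congr (_ + _ + _).
exact: scalar_commute.
Qed.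

Lemma idem_scale (X : lmodType R) u v (x : X) :
  E u *: (E v *: x) = if u == v then E v *: x else 0.
Proof. by rewrite scalerA fidem_mul; case: eqP => // _; rewrite scale0r. Qed.

Lemma idem_sum (X : lmodType R) (x : X) : \sum_v E v *: x = x.
Proof. by rewrite -scaler_suml fidem_sum scale1r. Qed.

(** C0, C1 and C2 are what adjunction leaves of Hom(-, N) applied to the
standard resolution of X by the modules R e_v (x) e_v X, then R e_j (x) e_i X for
the arrows i -> j together with R e_i (x) e_i T (x) w X, and R e_j (x) e_i T (x) w X
for the arrows i -> j, where w = E fpt. The factors R disappear, so that only
conditions over k remain. *)
Definition C0 (X : lmodType R) : set (X -> N) :=
  [set f | klin f /\ forall v x, f (E v *: x) = E v *: f x].

Definition C1a (X : lmodType R) : set (J -> X -> N) :=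
  [set g | forall a, [/\ klin (g a), forall x, g a (E (fsrc a) *: x) = g a x
    & forall x, E (ftgt a) *: g a x = g a x]].

Definition C1t (X : lmodType R) : set (X -> T -> N) :=
  [set h | [/\ kbilin h, forall x t, h (E w *: x) t = h x t
    & forall v x t, h x (eT v t) = E v *: h x t]].

Definition C1 (X : lmodType R) : set ((J -> X -> N) * (X -> T -> N)) :=
  [set u | C1a u.1 /\ C1t u.2].

Definition C2 (X : lmodType R) : set (J -> X -> T -> N) :=
  [set c | forall a, [/\ kbilin (c a), forall x t, c a (E w *: x) t = c a x t,
    forall x t, c a x (eT (fsrc a) t) = c a x t
    & forall x t, E (ftgt a) *: c a x t = c a x t]].

(** The failure of f to commute with the arrows and with T. *)
Definition d0 (X : lmodType R) (f : X -> N) : (J -> X -> N) * (X -> T -> N) :=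
  (fun a x => Ar a *: f x - f (Ar a *: x),
   fun x t => tt t *: f x - f (tt t *: x)).

(** The effect of the relation a t = (a t), with a an arrow and t in T, on such
failures. *)
Definition d1 (X : lmodType R) (u : (J -> X -> N) * (X -> T -> N)) :
    J -> X -> T -> N :=
  fun a x t => Ar a *: u.2 x t - u.2 x (aT a t) + u.1 a (tt t *: x).

Definition Z0 (X : lmodType R) : set (X -> N) := [set f | C0 f /\ d0 f = 0].

Definition Z1 (X : lmodType R) : set ((J -> X -> N) * (X -> T -> N)) :=
  [set u | C1 u /\ d1 u = 0].

Definition pull0 (X Y : lmodType R) (f : X -> Y) (u : Y -> N) : X -> N :=
  fun x => u (f x).

Definition pull1 (X Y : lmodType R) (f : X -> Y)
    (u : (J -> Y -> N) * (Y -> T -> N)) : (J -> X -> N) * (X -> T -> N) :=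
  (fun a x => u.1 a (f x), fun x => u.2 (f x)).

Definition pull2 (X Y : lmodType R) (f : X -> Y) (c : J -> Y -> T -> N) :
    J -> X -> T -> N :=
  fun a x => c a (f x).

Local Notation K0 X := (X -> kN).
Local Notation K1 X := ((J -> X -> kN) * (X -> T -> kN))%type.
Local Notation K2 X := (J -> X -> T -> kN).

Lemma cochain1_eq (X : lmodType R) (u v : (J -> X -> N) * (X -> T -> N)) :
  (forall a x, u.1 a x = v.1 a x) -> (forall x t, u.2 x t = v.2 x t) -> u = v.
Proof.
case: u v => [u1 u2] [v1 v2] /= uv1 uv2; congr (_, _).
  by apply: funext => a; apply: funext => x; exact: uv1.
by apply: funext => x; apply: funext => t; exact: uv2.
Qed.

Lemma cochain2_eq (X : lmodType R) (u v : J -> X -> T -> N) :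
  (forall a x t, u a x t = v a x t) -> u = v.
Proof.
by move=> uv; apply: funext => a; apply: funext => x; apply: funext => t.
Qed.

Lemma subsp_C0 (X : lmodType R) : subsp (C0 (X := X) : set (K0 X)).
Proof.
split=> [|c f g [fk fE] [gk gE]].
  split=> [c x y|v x]; first by rewrite -[RHS]/(c%:A *: 0 + 0 : N) scaler0 addr0.
  by rewrite -[RHS]/(E v *: 0 : N) scaler0.
split; first exact: klin_lincomb.
move=> v x; rewrite -[LHS]/(c%:A *: f (E v *: x) + g (E v *: x) : N).
by rewrite fE gE scalar_commute -scalerDr.
Qed.

Lemma kbilin_lincomb (X : lmodType R) (f g : X -> T -> N) a :
  kbilin f -> kbilin g -> kbilin (fun x t => a%:A *: f x t + g x t).
Proof.
move=> [fk fl] [gk gl]; split=> [t|x c t u]; first exact: klin_lincomb.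
rewrite fl gl !scalerDr addrACA; congr (_ + _ + _).
exact: scalar_commute.
Qed.

Lemma kbilin0 (X : lmodType R) : kbilin (fun (x : X) (t : T) => 0 : N).
Proof. by split=> [t c x y|x c t u]; rewrite scaler0 addr0. Qed.

Lemma subsp_C1a (X : lmodType R) : subsp (C1a (X := X) : set (J -> X -> kN)).
Proof.
split=> [a|c f g Cf Cg a].
  split=> [c x y|//|x].
    by rewrite -[RHS]/(c%:A *: 0 + 0 : N) scaler0 addr0.
  by rewrite -[LHS]/(E (ftgt a) *: 0 : N) scaler0.
have [fk fs ft] := Cf a; have [gk gs gt] := Cg a; split=> [|x|x].
- exact: klin_lincomb.
- by rewrite -[RHS]/(c%:A *: f a x + g a x : N) -fs -gs.
- rewrite -[LHS]/(E (ftgt a) *: (c%:A *: f a x + g a x) : N) scalerDr.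
  by rewrite -scalar_commute ft gt.
Qed.

Lemma subsp_C1t (X : lmodType R) : subsp (C1t (X := X) : set (X -> T -> kN)).
Proof.
split=> [|c f g [fk fp fE] [gk gp gE]].
  split=> // [|v x t]; first exact: kbilin0.
  by rewrite -[RHS]/(E v *: 0 : N) scaler0.
split=> [|x t|v x t].
- exact: kbilin_lincomb.
- by rewrite -[RHS]/(c%:A *: f x t + g x t : N) -fp -gp.
- rewrite -[LHS]/(c%:A *: f x (eT v t) + g x (eT v t) : N) fE gE.
  by rewrite scalar_commute -scalerDr.
Qed.

Lemma subsp_C1 (X : lmodType R) : subsp (C1 (X := X) : set (K1 X)).
Proof.
have [a0 aP] := subsp_C1a X; have [t0 tP] := subsp_C1t X.
split=> [|c [f f'] [g g'] [fa ft] [ga gt]]; first exact: (conj a0 t0).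
exact: (conj (aP c f g fa ga) (tP c f' g' ft gt)).
Qed.

Lemma subsp_C2 (X : lmodType R) : subsp (C2 (X := X) : set (K2 X)).
Proof.
split=> [a|c f g Cf Cg a].
  split=> // [|x t]; first exact: kbilin0.
  by rewrite -[LHS]/(E (ftgt a) *: 0 : N) scaler0.
have [fk fp fs ft] := Cf a; have [gk gp gs gt] := Cg a; split=> [|x t|x t|x t].
- exact: kbilin_lincomb.
- by rewrite -[RHS]/(c%:A *: f a x t + g a x t : N) -fp -gp.
- by rewrite -[RHS]/(c%:A *: f a x t + g a x t : N) -fs -gs.
- rewrite -[LHS]/(E (ftgt a) *: (c%:A *: f a x t + g a x t) : N) scalerDr.
  by rewrite -scalar_commute ft gt.
Qed.

Lemma d0_lin (X : lmodType R) : linear (d0 (X := X) : K0 X -> K1 X).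
Proof.
move=> c f g; apply: cochain1_eq => [a x|x t].
  rewrite -[RHS]/(c%:A *: (Ar a *: f x - f (Ar a *: x)) +
    (Ar a *: g x - g (Ar a *: x)) : N).
  rewrite -[LHS]/(Ar a *: (c%:A *: f x + g x) -
    (c%:A *: f (Ar a *: x) + g (Ar a *: x)) : N).
  by rewrite scalerDr scalerBr opprD addrACA scalar_commute.
rewrite -[RHS]/(c%:A *: (tt t *: f x - f (tt t *: x)) +
  (tt t *: g x - g (tt t *: x)) : N).
rewrite -[LHS]/(tt t *: (c%:A *: f x + g x) -
  (c%:A *: f (tt t *: x) + g (tt t *: x)) : N).
by rewrite scalerDr scalerBr opprD addrACA scalar_commute.
Qed.

Lemma d1_lin (X : lmodType R) : linear (d1 (X := X) : K1 X -> K2 X).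
Proof.
move=> c [u1 u2] [v1 v2]; apply: cochain2_eq => a x t.
rewrite -[RHS]/(c%:A *: (Ar a *: u2 x t - u2 x (aT a t) + u1 a (tt t *: x)) +
  (Ar a *: v2 x t - v2 x (aT a t) + v1 a (tt t *: x)) : N).
rewrite -[LHS]/(Ar a *: (c%:A *: u2 x t + v2 x t) -
  (c%:A *: u2 x (aT a t) + v2 x (aT a t)) +
  (c%:A *: u1 a (tt t *: x) + v1 a (tt t *: x)) : N).
by rewrite !scalerDr scalerN scalar_commute addr_shuffle.
Qed.

Lemma femb_scale (X : lmodType R) c t u (x : X) :
  tt (c *: t + u) *: x = c%:A *: (tt t *: x) + tt u *: x.
Proof. by rewrite femb_lin scalerDl scalerA mulr_algl. Qed.

Lemma d0_C1 (X : lmodType R) (f : X -> N) : C0 f -> C1 (d0 f).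
Proof.
move=> [fk fE]; split=> [a|]; split=> /=.
- move=> c x y; rewrite fk !scalerDr -!scalar_commute fk scalerN opprD.
  by rewrite addrACA.
- by move=> x; rewrite fE !scalerA farr_src.
- by move=> x; rewrite scalerBr -fE !scalerA farr_tgt.
- split=> [t c x y|x c t u].
    by rewrite fk !scalerDr -!scalar_commute fk scalerN opprD addrACA.
  by rewrite !femb_scale fk scalerBr opprD addrACA.
- by move=> x t; rewrite fE !scalerA femb_pt.
- by move=> v x t; rewrite femb_idem scalerBr -!scalerA fE.
Qed.

Lemma d1_C2 (X : lmodType R) (u : (J -> X -> N) * (X -> T -> N)) :
  C1 u -> C2 (d1 u).
Proof.
move=> [ga [[hl hr] hw hE]] a; have [gk gs gt] := ga a; split=> [|x t|x t|x t].
- split=> [t c x y|x c t t'].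
    rewrite /d1 !hl !scalerDr -!scalar_commute gk addr_shuffle scalerN.
    by [].
  rewrite /d1 farrT_lin !hr femb_scale gk !scalerDr -!scalar_commute.
  by rewrite addr_shuffle scalerN.
- by rewrite /d1 !hw scalerA femb_pt.
- by rewrite /d1 farrT_src hE scalerA farr_src femb_idem -scalerA gs.
- rewrite /d1 scalerDr scalerBr gt scalerA farr_tgt -hE farrT_tgt.
  by [].
Qed.

Lemma d1d0 (X : lmodType R) (f : X -> N) : C0 f -> d1 (d0 f) = 0.
Proof.
move=> [fk fE]; apply: cochain2_eq => a x t; rewrite /d1 /d0 /=.
rewrite femb_arr scalerBr -!scalerA.
set A := Ar a *: (tt t *: f x); set B := Ar a *: f _; set D := f (Ar a *: _).
by rewrite opprB addrACA subrK [D - A]addrC addrK subrr.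
Qed.

Lemma kbilin_r0 (X : lmodType R) (h : X -> T -> N) x : kbilin h -> h x 0 = 0.
Proof.
move=> [_ hr]; have := hr x (-1) 0 0.
by rewrite !scaleN1r oppr0 addr0 addNr.
Qed.

Section Pull.
Variables (X Y : lmodType R) (f : X -> Y).
Hypothesis fk : klin f.
Hypothesis fE : forall v x, f (E v *: x) = E v *: f x.

Lemma pull0_C0 u : C0 u -> C0 (pull0 f u).
Proof.
by move=> [uk uE]; split=> [|v x]; [exact: klin_comp | rewrite /pull0 fE uE].
Qed.

Lemma pull1_C1 u : C1 u -> C1 (pull1 f u).
Proof.
move=> [ga [[hl hr] hw hE]]; split=> [a|].
  have [gk gs gt] := ga a; split=> [|x|x] /=; last exact: gt.
    exact: klin_comp.
  by rewrite fE gs.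
split=> /= [|x t|v x t]; last exact: hE.
- by split=> [t|x c t t']; [exact: (klin_comp (hl t)) | exact: hr].
- by rewrite fE hw.
Qed.

Lemma pull2_C2 c : C2 c -> C2 (pull2 f c).
Proof.
move=> Cc a; have [[cl cr] cw cs ct] := Cc a; split=> [|x t|x t|x t].
- by split=> [t|x b t t']; [exact: (klin_comp (cl t)) | exact: cr].
- by rewrite /pull2 fE cw.
- exact: cs.
- exact: ct.
Qed.

End Pull.

Lemma pull0_lin (X Y : lmodType R) (f : X -> Y) : linear (pull0 f : K0 Y -> K0 X).
Proof. by []. Qed.

Lemma pull1_lin (X Y : lmodType R) (f : X -> Y) : linear (pull1 f : K1 Y -> K1 X).
Proof. by []. Qed.

Lemma pull2_lin (X Y : lmodType R) (f : X -> Y) : linear (pull2 f : K2 Y -> K2 X).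
Proof. by []. Qed.

Lemma d0_pull (X Y : lmodType R) (f : {linear X -> Y}) u :
  d0 (pull0 f u) = pull1 f (d0 u).
Proof. by apply: cochain1_eq => [a x|x t]; rewrite /= /pull0 !linearZ. Qed.

Lemma d1_pull (X Y : lmodType R) (f : {linear X -> Y}) u :
  d1 (pull1 f u) = pull2 f (d1 u).
Proof.
by apply: cochain2_eq => a x t; rewrite /d1 /pull2 /pull1 /= linearZ.
Qed.

Lemma subsp_Z0 (X : lmodType R) : subsp (Z0 (X := X) : set (K0 X)).
Proof.
by apply: (@subsp_kernel k (K0 X) (K1 X)); [exact: d0_lin | exact: subsp_C0].
Qed.

Lemma subsp_Z1 (X : lmodType R) : subsp (Z1 (X := X) : set (K1 X)).
Proof.
by apply: (@subsp_kernel k (K1 X) (K2 X)); [exact: d1_lin | exact: subsp_C1].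
Qed.

Definition acyclic1 (Y : lmodType R) : Prop :=
  forall u, Z1 (X := Y) u -> exists2 f, C0 f & d0 f = u.

Definition acyclic2 (Y : lmodType R) : Prop :=
  forall c, C2 (X := Y) c -> exists2 u, C1 u & d1 u = c.

Lemma linear_equivariant (Y Z : lmodType R) (f : {linear Y -> Z}) :
  forall v x, f (E v *: x) = E v *: f x.
Proof. by move=> v x; rewrite linearZ. Qed.

Section ShortExact.
Variables (K F X : lmodType R) (i : {linear K -> F}) (p : {linear F -> X}).
Hypothesis i_inj : injective i.
Hypothesis p_surj : forall x, exists y, p y = x.
Hypothesis ip_exact : forall x, p x = 0 <-> exists y, i y = x.

(** A retraction linear over k is averaged over the idempotents; the
corresponding section of p comes for free. *)
Lemma equivariant_splitting : exists (s : F -> K) (q : X -> F),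
  [/\ klin s /\ forall v x, s (E v *: x) = E v *: s x,
      klin q /\ forall v x, q (E v *: x) = E v *: q x,
      forall y, s (i y) = y
    & forall x, q (p x) = x - i (s x)].
Proof.
have i_lin : linear (i : kmod K -> kmod F) by exact: linear_klin.
have [s0 [s0_lin s0K]] := linear_retraction i_lin i_inj.
have s0k : klin (s0 : F -> K) by exact: s0_lin.
pose s (x : F) : K := \sum_v E v *: (s0 (E v *: x) : K).
have sk : klin s.
  move=> c x y; rewrite /s scaler_sumr -big_split; apply: eq_bigr => v _ /=.
  by rewrite scalerDr -scalar_commute s0k scalerDr -scalar_commute.
have sE v x : s (E v *: x) = E v *: s x.
  rewrite /s scaler_sumr; apply: eq_bigr => u _.
  rewrite !idem_scale eq_sym; case: eqP => // [-> //|_].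
  by rewrite (klin0 s0k) scaler0.
have sK y : s (i y) = y.
  rewrite -[RHS]idem_sum; apply: eq_bigr => v _.
  by rewrite -linearZ [s0 _]s0K idem_scale eqxx.
have [l lK] := choice p_surj.
pose q x := l x - i (s (l x)).
have qp x : q (p x) = x - i (s x).
  apply/eqP; rewrite -subr_eq0 /q; apply/eqP.
  have /ip_exact[y yE] : p (l (p x) - x) = 0 by rewrite linearB lK subrr.
  have -> : l (p x) = i y + x by rewrite yE subrK.
  by rewrite (klinD sk) sK linearD opprD addrACA subrr add0r subrr.
exists s, q; split=> //; split=> [c x y|v x].
  have [x' <-] := p_surj x; have [y' <-] := p_surj y.
  rewrite -linearP !qp sk linearP /= scalerBr opprD addrACA.
  by [].
have [x' <-] := p_surj x.
by rewrite -linearZ !qp sE linearZ /= scalerBr.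
Qed.

(** Cochains extend by pullback along the equivariant retraction. *)
Lemma restriction0_onto f : C0 (X := K) f -> exists2 f', C0 f' & pull0 i f' = f.
Proof.
have [s [q [[sk sE] _ sK _]]] := equivariant_splitting => Cf.
exists (pull0 s f); first exact: pull0_C0.
by apply: funext => x; rewrite /pull0 sK.
Qed.

Lemma restriction1_onto u : C1 (X := K) u -> exists2 u', C1 u' & pull1 i u' = u.
Proof.
have [s [q [[sk sE] _ sK _]]] := equivariant_splitting => Cu.
exists (pull1 s u); first exact: pull1_C1.
by apply: cochain1_eq => [a x|x t]; rewrite /= sK.
Qed.

Lemma restriction2_onto c : C2 (X := K) c -> exists2 c', C2 c' & pull2 i c' = c.
Proof.
have [s [q [[sk sE] _ sK _]]] := equivariant_splitting => Cc.
exists (pull2 s c); first exact: pull2_C2.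
by apply: cochain2_eq => a x t; rewrite /pull2 sK.
Qed.

(** A cochain that vanishes on K factors through p, by way of the section q. *)
Lemma descent0 f : C0 (X := F) f -> pull0 i f = 0 ->
  exists2 g, C0 g & pull0 p g = f.
Proof.
have [s [q [_ [qk qE] _ qp]]] := equivariant_splitting => Cf f0.
exists (pull0 q f); first exact: pull0_C0.
apply: funext => x; rewrite /pull0 qp (klinB Cf.1).
by rewrite -[f (i _)]/(pull0 i f (s x)) f0 subr0.
Qed.

Lemma descent1 u : C1 (X := F) u -> pull1 i u = 0 ->
  exists2 v, C1 v & pull1 p v = u.
Proof.
have [s [q [_ [qk qE] _ qp]]] := equivariant_splitting => Cu u0.
exists (pull1 q u); first exact: pull1_C1.
case: Cu => Ca [[ul _] _ _]; apply: cochain1_eq => [a x|x t]; rewrite /= qp.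
  have [uk _ _] := Ca a; rewrite (klinB uk).
  by rewrite -[u.1 a (i _)]/((pull1 i u).1 a (s x)) u0 subr0.
rewrite (klinB (ul t)) /=.
by rewrite -[u.2 (i _) t]/((pull1 i u).2 (s x) t) u0 subr0.
Qed.

Lemma descent2 c : C2 (X := F) c -> pull2 i c = 0 ->
  exists2 c', C2 c' & pull2 p c' = c.
Proof.
have [s [q [_ [qk qE] _ qp]]] := equivariant_splitting => Cc c0.
exists (pull2 q c); first exact: pull2_C2.
apply: cochain2_eq => a x t; have [[cl _] _ _ _] := Cc a.
rewrite /pull2 qp (klinB (cl t)) /=.
by rewrite -[c a (i _) t]/(pull2 i c a (s x) t) c0 subr0.
Qed.

Lemma pi0 x : p (i x) = 0.
Proof. by apply/ip_exact; exists x. Qed.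

Lemma pull0_pi f : C0 (X := X) f -> pull0 i (pull0 p f) = 0.
Proof.
by move=> [fk _]; apply: funext => x; rewrite /pull0 pi0 (klin0 fk).
Qed.

Lemma pull1_pi u : C1 (X := X) u -> pull1 i (pull1 p u) = 0.
Proof.
move=> [Ca [[ul _] _ _]]; apply: cochain1_eq => [a x|x t]; rewrite /= pi0.
  by have [uk _ _] := Ca a; rewrite (klin0 uk).
exact: (klin0 (ul t)).
Qed.

Lemma pull2_pi c : C2 (X := X) c -> pull2 i (pull2 p c) = 0.
Proof.
move=> Cc; apply: cochain2_eq => a x t; have [[cl _] _ _ _] := Cc a.
by rewrite /pull2 pi0 (klin0 (cl t)).
Qed.

Lemma pull1_inj u v : pull1 p u = pull1 p v -> u = v.
Proof.
move=> uv; apply: cochain1_eq => [a x|x t]; have [y <-] := p_surj x.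
  by rewrite -[LHS]/((pull1 p u).1 a y) uv.
by rewrite -[LHS]/((pull1 p u).2 y t) uv.
Qed.

Lemma pull2_inj u v : pull2 p u = pull2 p v -> u = v.
Proof.
move=> uv; apply: cochain2_eq => a x t; have [y <-] := p_surj x.
by rewrite -[LHS]/(pull2 p u a y t) uv.
Qed.

Lemma connecting0 : acyclic1 F ->
  quot_corr (Z0 (X := K) : set (K0 K)) (pull0 i @` Z0 (X := F))
    (Z1 (X := X) : set (K1 X)) (@d0 X @` C0 (X := X))
    (fun f u => exists f', [/\ C0 f', pull0 i f' = f & d0 f' = pull1 p u]).
Proof.
move=> acF; apply: (@connecting_corr k (K0 F) (K0 K) (K0 X) (K1 F) (K1 K) (K1 X)
    (C0 (X := F)) (C0 (X := K)) (C0 (X := X)) (Z1 (X := F)) (Z1 (X := X))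
    (pull0 p) (pull0 i) (pull1 p) (pull1 i)
    (@d0 F) (@d0 K) (@d0 X)).
- exact: pull0_lin.
- exact: d0_lin.
- exact: pull1_lin.
- exact: subsp_C0.
- by move=> g; apply: pull0_C0; [exact: linear_klin | exact: linear_equivariant].
- by move=> g; apply: pull0_C0; [exact: linear_klin | exact: linear_equivariant].
- exact: restriction0_onto.
- exact: pull0_pi.
- exact: descent0.
- exact: pull1_inj.
- by move=> u [Cu _]; exact: pull1_pi.
- move=> u [Cu du]; split.
    by apply: pull1_C1 => //; [exact: linear_klin | exact: linear_equivariant].
  by rewrite d1_pull du; exact: cochain2_eq.
- move=> u [Cu du] u0; have [v Cv vE] := descent1 Cu u0; exists v => //.
  split=> //; apply: pull2_inj; rewrite -d1_pull vE du.
  exact: cochain2_eq.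
- by move=> f Cf; split; [exact: d0_C1 | exact: d1d0].
- exact: acF.
- by move=> g _; exact: d0_pull.
- by move=> g _; exact: d0_pull.
Qed.

Lemma connecting1 : acyclic1 F -> acyclic2 F ->
  quot_corr (Z1 (X := K) : set (K1 K)) (@d0 K @` C0 (X := K))
    (C2 (X := X) : set (K2 X)) (@d1 X @` C1 (X := X))
    (fun u c => exists u', [/\ C1 u', pull1 i u' = u & d1 u' = pull2 p c]).
Proof.
move=> ac1 ac2.
(* cocycles on F are coboundaries, and coboundaries on K lift to F *)
have -> : @d0 K @` C0 (X := K) = pull1 i @` Z1 (X := F).
  apply/seteqP; split=> [_ [f Cf <-]|_ [u Zu <-]].
    have [f' Cf' <-] := restriction0_onto Cf.
    by exists (d0 f'); [split; [exact: d0_C1 | exact: d1d0] | rewrite d0_pull].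
  have [f Cf <-] := ac1 _ Zu; exists (pull0 i f); last by rewrite d0_pull.
  by apply: pull0_C0 => //; [exact: linear_klin | exact: linear_equivariant].
apply: (@connecting_corr k (K1 F) (K1 K) (K1 X) (K2 F) (K2 K) (K2 X)
    (C1 (X := F)) (C1 (X := K)) (C1 (X := X)) (C2 (X := F)) (C2 (X := X))
    (pull1 p) (pull1 i) (pull2 p) (pull2 i)
    (@d1 F) (@d1 K) (@d1 X)).
- exact: pull1_lin.
- exact: d1_lin.
- exact: pull2_lin.
- exact: subsp_C1.
- by move=> g; apply: pull1_C1; [exact: linear_klin | exact: linear_equivariant].
- by move=> g; apply: pull1_C1; [exact: linear_klin | exact: linear_equivariant].
- exact: restriction1_onto.
- exact: pull1_pi.
- exact: descent1.
- exact: pull2_inj.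
- exact: pull2_pi.
- by move=> c; apply: pull2_C2; [exact: linear_klin | exact: linear_equivariant].
- exact: descent2.
- exact: d1_C2.
- exact: ac2.
- by move=> g _; exact: d1_pull.
- by move=> g _; exact: d1_pull.
Qed.

Lemma acyclic2_sub : acyclic2 F -> acyclic2 K.
Proof.
move=> ac2 c Cc; have [c' Cc' <-] := restriction2_onto Cc.
have [u Cu <-] := ac2 _ Cc'; exists (pull1 i u); last by rewrite d1_pull.
by apply: pull1_C1 => //; [exact: linear_klin | exact: linear_equivariant].
Qed.

End ShortExact.

End Complex.

(** * Dimension shifting *)

Section DimensionShift.
Variables (k : fieldType) (R : algType k) (S : frame R) (M N : lmodType R).
Hypothesis generated : forall (X : lmodType R) (f : X -> N),
  Z0 S f <-> linear f.
Hypothesis free_acyclic1 : forall X, acyclic1 S N (free_cover X).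
Hypothesis free_acyclic2 : forall X, acyclic2 S N (free_cover X).
Local Notation kN := (restr (in_alg R) N).
Local Notation K n := (iter_syzygy M n).
Local Notation F n := (free_mod M n).
Local Notation i n := (val : {linear K n.+1 -> F n}).
Local Notation p n := (@cover_map R (K n) : {linear F n -> K n}).

Lemma syz_inj n : injective (i n).
Proof. exact: val_inj. Qed.

Lemma cover_surj n x : exists y, p n y = x.
Proof. by exists << x >>; exact: cover_mapU. Qed.

Lemma syz_exact n x : p n x = 0 <-> exists y, i n y = x.
Proof.
split=> [x0|[y <-]]; last by apply/eqP; exact: (valP y).
have xK : x \in @cover_ker R (K n) by apply/eqP.
by exists (Syzygy xK).
Qed.

(** A linear map on the syzygy K n represents 0 in Ext^n if it extends to the
free module that contains K n. *)
Definition syzygy_boundary n : set (K n -> kN) :=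
  match n return set (K n -> kN) with
  | 0 => [set 0]
  | m.+1 => pull0 (i m) @` Z0 S (N := N) (X := F m)
  end.

(** Cocycles on the free module over K n vanish on the next syzygy, so they
are the pullbacks of linear maps on K n. *)
Lemma ext_corr n :
  quot_corr (Z0 S (N := N) (X := K n) : set (K n -> kN)) (@syzygy_boundary n)
    (@cocycle k R M N (free_resolution M) n)
    (@coboundary k R M N (free_resolution M) n)
    (fun f g => g = pull0 (p n) f).
Proof.
split.
- by move=> c f f' g g' -> ->.
- move=> f /generated f_lin; exists (pull0 (p n) f) => //; split.
    by move=> c x y; rewrite /pull0 linearP f_lin.
  move=> x; rewrite /pull0 (_ : p n _ = 0); last first.
    by apply/syz_exact; exists (p n.+1 x).
  exact: (linear_map0 f_lin).
- move=> g [g_lin g0].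
  have g_i y : g (i n y) = 0.
    by have [x <-] := cover_surj y; exact: g0.
  have g_p x y : p n x = p n y -> g x = g y.
    move=> xy; have /syz_exact[z zE] : p n (x - y) = 0.
      by rewrite linearB /= xy subrr.
    have -> : x = 1 *: (x - y) + y by rewrite scale1r subrK.
    by rewrite g_lin -zE g_i scaler0 add0r.
  have pU x : p n << x >> = x by exact: cover_mapU.
  exists (fun x => g << x >>).
    apply/generated => c x y; rewrite -g_lin; apply: g_p.
    by rewrite linearP !pU.
  by apply: funext => x; apply: g_p; rewrite pU.
- move=> f g /generated f_lin Zg ->; case: n f f_lin g Zg => [|n] f f_lin g Zg /=.
    split=> [->|f0]; first by [].
    apply: funext => x; have [y <-] := @cover_surj 0 x.
    by rewrite -[LHS]/(pull0 (p 0) f y) f0.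
  split=> [[h /generated h_lin <-]|[h h_lin hE]]; first by exists h.
  exists h; first exact/generated.
  apply: funext => x; have [y <-] := @cover_surj n.+1 x.
  by rewrite -[RHS]/(pull0 (p n.+1) f y) -hE.
Qed.

Lemma subsp_cocycle n :
  subsp (@cocycle k R M N (free_resolution M) n).
Proof.
split=> [|c f g [f_lin f0] [g_lin g0]]; split=> [|x] //.
- by move=> a x y; rewrite -[RHS]/(a *: 0 + 0 : N) scaler0 addr0.
- move=> a x y; rewrite -[LHS]/(c%:A *: f (a *: x + y) + g (a *: x + y) : N).
  rewrite f_lin g_lin scalerDr addrACA scalar_commute.
  by rewrite -[RHS]/(a *: (c%:A *: f x + g x) + (c%:A *: f y + g y) : N) scalerDr.
- rewrite -[LHS]/(c%:A *: f (res_diff (free_resolution M) n x) +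
    g (res_diff (free_resolution M) n x) : N).
  by rewrite f0 g0 scaler0 addr0.
Qed.

Lemma subsp_coboundary n :
  subsp (@coboundary k R M N (free_resolution M) n).
Proof.
case: n => [|n]; first exact: subsp0.
apply: (@subsp_image k (F n -> kN) (F n.+1 -> kN)); first by [].
split=> [|c f g f_lin g_lin] a x y.
  by rewrite -[RHS]/(a *: 0 + 0 : N) scaler0 addr0.
rewrite -[LHS]/(c%:A *: f (a *: x + y) + g (a *: x + y) : N).
rewrite f_lin g_lin scalerDr addrACA scalar_commute.
by rewrite -[RHS]/(a *: (c%:A *: f x + g x) + (c%:A *: f y + g y) : N) scalerDr.
Qed.

Lemma subsp_syzygy_boundary n : subsp (@syzygy_boundary n).
Proof.
case: n => [|n]; first exact: subsp0.
by apply: (@subsp_image k (F n -> kN) (K n.+1 -> kN)) => //; exact: subsp_Z0.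
Qed.

Local Notation has_ext_dim n d :=
  (has_quot_dim (@cocycle k R M N (free_resolution M) n)
    (@coboundary k R M N (free_resolution M) n) d).
Local Notation B1 X := (@d0 k R S N X @` C0 S (N := N) (X := X)).
Local Notation B2 X := (@d1 k R S N X @` @C1 k R S N X).
Local Notation Z1 X := (@Z1 k R S N X :
  set ((farrow S -> X -> kN) * (X -> fspace S -> kN))).
Local Notation C2 X := (@C2 k R S N X :
  set (farrow S -> X -> fspace S -> kN)).

Lemma subsp_B1 (X : lmodType R) :
  subsp (B1 X : set ((farrow S -> X -> kN) * (X -> fspace S -> kN))).
Proof.
apply: (@subsp_image k (X -> kN)); first exact: d0_lin.
exact: subsp_C0.
Qed.

Lemma subsp_B2 (X : lmodType R) :
  subsp (B2 X : set (farrow S -> X -> fspace S -> kN)).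
Proof.
apply: (@subsp_image k ((farrow S -> X -> kN) * (X -> fspace S -> kN))%type).
  exact: d1_lin.
exact: subsp_C1.
Qed.

Lemma ext_dim_Z0 n d :
  has_quot_dim (Z0 S (N := N) (X := K n) : set (K n -> kN))
    (@syzygy_boundary n) d -> has_ext_dim n d.
Proof.
apply: (has_quot_dim_corr _ _ _ _ (@ext_corr n)).
- exact: subsp_Z0.
- exact: subsp_syzygy_boundary.
- exact: subsp_cocycle.
- exact: subsp_coboundary.
Qed.

Lemma ext_dim0 d :
  has_quot_dim (Z0 S (N := N) (X := M) : set (M -> kN)) [set 0] d ->
  has_ext_dim 0 d.
Proof. exact: (@ext_dim_Z0 0). Qed.

(** One step of dimension shifting, from K n.+1 to K n. *)
Lemma ext_dim_Z1 n d : has_quot_dim (Z1 (K n)) (B1 (K n)) d -> has_ext_dim n.+1 d.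
Proof.
move=> dZ1; apply: ext_dim_Z0.
have corr := connecting0 (@syz_inj n) (@cover_surj n) (@syz_exact n)
  (@free_acyclic1 (K n)).
apply: (has_quot_dim_corr _ _ _ _ (quot_corr_sym corr)) dZ1.
- exact: subsp_Z1.
- exact: subsp_B1.
- exact: subsp_Z0.
- exact: (@subsp_syzygy_boundary n.+1).
Qed.

Lemma ext_dim1 d : has_quot_dim (Z1 M) (B1 M) d -> has_ext_dim 1 d.
Proof. exact: (@ext_dim_Z1 0). Qed.

(** Two steps of dimension shifting, from K n.+2 to K n. *)
Lemma ext_dim_C2 n d : has_quot_dim (C2 (K n)) (B2 (K n)) d -> has_ext_dim n.+2 d.
Proof.
move=> dC2; apply: ext_dim_Z1.
have corr := connecting1 (@syz_inj n) (@cover_surj n) (@syz_exact n)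
  (@free_acyclic1 (K n)) (@free_acyclic2 (K n)).
apply: (has_quot_dim_corr _ _ _ _ (quot_corr_sym corr)) dC2.
- exact: subsp_C2.
- exact: subsp_B2.
- exact: subsp_Z1.
- exact: subsp_B1.
Qed.

Lemma ext_dim2 d : has_quot_dim (C2 M) (B2 M) d -> has_ext_dim 2 d.
Proof. exact: (@ext_dim_C2 0). Qed.

(** Every 2-cochain on a syzygy extends to the free module that contains it,
where it is a coboundary. *)
Lemma ext_dim_ge3 n : has_ext_dim n.+3 0.
Proof.
apply: ext_dim_C2; apply: has_quot_dim0.
- exact: subsp_C2.
- move=> c Cc.
  have [u Cu <-] := acyclic2_sub (@syz_inj n) (@cover_surj n) (@syz_exact n)
    (@free_acyclic2 (K n)) Cc.
  by exists u.
- exact: subsp_B2.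
Qed.

End DimensionShift.

(** * Euler characteristics *)

Section EulerCharacteristic.
Variables (k : fieldType) (V0 V1 V2 : lmodType k).
Variables (U0 : set V0) (U1 : set V1) (U2 : set V2).
Variables (d : V0 -> V1) (e : V1 -> V2).
Hypothesis sU0 : subsp U0.
Hypothesis sU1 : subsp U1.
Hypothesis sU2 : subsp U2.
Hypothesis d_lin : linear d.
Hypothesis e_lin : linear e.
Hypothesis dU : forall x, U0 x -> U1 (d x).
Hypothesis eU : forall x, U1 x -> U2 (e x).
Hypothesis ed0 : forall x, U0 x -> e (d x) = 0.

(** Rank-nullity for both differentials. *)
Lemma three_term_euler c0 c1 c2 :
  has_quot_dim U0 [set 0] c0 -> has_quot_dim U1 [set 0] c1 ->
  has_quot_dim U2 [set 0] c2 ->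
  exists h0 h1 h2,
  [/\ has_quot_dim [set x | U0 x /\ d x = 0] [set 0] h0,
      has_quot_dim [set x | U1 x /\ e x = 0] (d @` U0) h1,
      has_quot_dim U2 (e @` U1) h2
    & (h0 + h2 + c1 = h1 + c0 + c2)%N].
Proof.
move=> dim0 dim1 dim2.
have sZ0 := subsp_kernel d_lin sU0; have sZ1 := subsp_kernel e_lin sU1.
have sB1 := subsp_image d_lin sU0; have sB2 := subsp_image e_lin sU1.
have s0 (V : lmodType k) : subsp [set 0 : V] by exact: subsp0.
have unq (V : lmodType k) (U : set V) m n : subsp U ->
    has_quot_dim U [set 0] m -> has_quot_dim U [set 0] n -> m = n.
  by move=> sU Um Un; rewrite -(quot_dimE sU (s0 V) Um) (quot_dimE sU (s0 V) Un).
have zin (V : lmodType k) (U : set V) : subsp U -> [set 0] `<=` U.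
  by move=> [U0' _] _ ->.
have Z0U : [set x | U0 x /\ d x = 0] `<=` U0 by move=> x [].
have Z1U : [set x | U1 x /\ e x = 0] `<=` U1 by move=> x [].
have B1Z : d @` U0 `<=` [set x | U1 x /\ e x = 0].
  by move=> _ [x Ux <-]; split; [exact: dU | exact: ed0].
have B2U : e @` U1 `<=` U2 by move=> _ [x Ux <-]; exact: eU.
have [[r0 R0] [h0 H0]] := quot_findim_split sU0 sZ0 (s0 _) (zin _ _ sZ0) Z0U dim0.
have [[r1 R1] [z1 H1]] := quot_findim_split sU1 sZ1 (s0 _) (zin _ _ sZ1) Z1U dim1.
have [[h1 H1'] [b1 B1]] := quot_findim_split sZ1 sB1 (s0 _) (zin _ _ sB1) B1Z H1.
have [[h2 H2] [b2 B2]] := quot_findim_split sU2 sB2 (s0 _) (zin _ _ sB2) B2U dim2.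
exists h0, h1, h2; split=> //.
have E0 := unq _ _ _ _ sU0 dim0
  (quot_dim_add sU0 sZ0 (s0 _) (zin _ _ sZ0) Z0U R0 H0).
have E1 := unq _ _ _ _ sU1 dim1
  (quot_dim_add sU1 sZ1 (s0 _) (zin _ _ sZ1) Z1U R1 H1).
have E1' := unq _ _ _ _ sZ1 H1
  (quot_dim_add sZ1 sB1 (s0 _) (zin _ _ sB1) B1Z H1' B1).
have E2 := unq _ _ _ _ sU2 dim2
  (quot_dim_add sU2 sB2 (s0 _) (zin _ _ sB2) B2U H2 B2).
have Eb1 := unq _ _ _ _ sB1 B1 (has_dim_image d_lin sU0 R0).
have Eb2 := unq _ _ _ _ sB2 B2 (has_dim_image e_lin sU1 R1).
rewrite E0 E1 E1' E2 Eb1 Eb2.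
lia.
Qed.

End EulerCharacteristic.

Section ComplexDimensions.
Variables (k : fieldType) (R : algType k) (S : frame R) (M N : lmodType R).
Local Notation V := (fvertex S).
Local Notation J := (farrow S).
Local Notation T := (fspace S).
Local Notation E := (@fidem _ _ S).
Local Notation eT := (@fidemT _ _ S).
Local Notation w := (fpt S).
Local Notation kmod X := (restr (in_alg R) X).
Local Notation kM := (kmod M).
Local Notation kN := (kmod N).

Definition idem_act (X : lmodType R) (v : V) (y : kmod X) : kmod X :=
  E v *: (y : X).

Definition idem_range (X : lmodType R) (v : V) : set (kmod X) :=
  range (@idem_act X v).

Variables (x n t : V -> nat).
Hypothesis dimM : forall v, has_quot_dim (@idem_range M v) [set 0] (x v).
Hypothesis dimN : forall v, has_quot_dim (@idem_range N v) [set 0] (n v).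
Hypothesis dimT : forall v, has_quot_dim (range (eT v)) [set 0] (t v).

Lemma idem_rangeP (X : lmodType R) v (y : X) :
  @idem_range X v y <-> E v *: y = y.
Proof.
split=> [[z _ <-]|yE]; last by exists y.
by rewrite idem_scale eqxx.
Qed.

Lemma subsp_idem_range (X : lmodType R) v : subsp (@idem_range X v).
Proof.
apply: (@subsp_image k (kmod X) (kmod X)); last exact: subspT.
exact: klin_scale.
Qed.

Lemma idem_linear (X : lmodType R) v :
  linear (@idem_act X v).
Proof. exact: klin_scale. Qed.

Lemma dim_corner u v :
  has_quot_dim (khom (@idem_act M u) (@idem_range N v) : set (kM -> kN))
    [set 0] (x u * n v).
Proof.
apply: has_dim_khom (dimM u) (dimN v).
- exact: idem_linear.
- by move=> y; rewrite /idem_act idem_scale eqxx.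
- exact: subsp_idem_range.
Qed.

Definition corner_T (u v : V) : set (T -> kN) := khom (eT u) (@idem_range N v).

Lemma subsp_corner_T u v : subsp (corner_T u v).
Proof. exact/subsp_khom/subsp_idem_range. Qed.

Lemma dim_corner_T u v :
  has_quot_dim (khom (@idem_act M w) (corner_T u v) : set (kM -> T -> kN))
    [set 0] (x w * (t u * n v)).
Proof.
apply: has_dim_khom (dimM w) _.
- exact: idem_linear.
- by move=> y; rewrite /idem_act idem_scale eqxx.
- exact: subsp_corner_T.
apply: has_dim_khom (dimT u) (dimN v).
- exact: fidemT_lin.
- by move=> y; rewrite fidemT_mul eqxx.
- exact: subsp_idem_range.
Qed.

(** The idempotents sum to 1, so a 0-cochain is given by its restrictions to the
spaces E v M. *)
Lemma dim_C0 :
  has_quot_dim (C0 S (N := N) (X := M) : set (M -> kN)) [set 0]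
    (\sum_v x v * n v).
Proof.
have sK v : subsp (khom (@idem_act M v) (@idem_range N v) : set (kM -> kN)).
  exact/subsp_khom/subsp_idem_range.
apply: (has_quot_dim_corr (rho := fun (g : V -> kM -> kN) (f : kM -> kN) =>
  forall v y, f (E v *: (y : M)) = g v y)) (has_dim_family sK (fun v => dim_corner v v)).
- exact: (subsp_family sK).
- exact: subsp0.
- exact: subsp_C0.
- exact: subsp0.
split=> [c g f g' f' gf gf' v y|g Kg|f [fk fE]|g f Kg [fk fE] gf].
- by rewrite -[LHS]/(c *: f (E v *: (y : M)) + f' (E v *: (y : M))) gf gf'.
- have gv u v y : g u (E v *: (y : M)) = if u == v then g v y else 0.
    have [gk gE _] := Kg u; case: eqP => [<-|/eqP uv]; first exact: gE.
    by rewrite -gE /idem_act idem_scale (negPf uv); exact: (klin0 gk).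
  exists (fun y => \sum_v g v y : N).
    split=> [c y y'|v y].
      rewrite scaler_sumr -big_split; apply: eq_bigr => v _ /=.
      by have [gk _ _] := Kg v; exact: (gk c y y').
    rewrite (bigD1 v) //= gv eqxx big1 ?addr0 => [|u uv]; last by rewrite gv (negPf uv).
    rewrite scaler_sumr (bigD1 v) //= big1 ?addr0 => [|u uv].
      by have [_ _ /(_ y)/idem_rangeP ->] := Kg v.
    have [_ _ /(_ y)/idem_rangeP <-] := Kg u.
    by rewrite idem_scale eq_sym (negPf uv).
  move=> v y; rewrite (bigD1 v) //= gv eqxx big1 ?addr0 // => u uv.
  by rewrite gv (negPf uv).
- exists (fun v y => f (E v *: (y : M))) => //= v; split.
  + exact: (klin_comp fk (klin_scale (E v))).
  + by move=> y; rewrite /idem_act idem_scale eqxx.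
  + by move=> y; apply/idem_rangeP; rewrite fE idem_scale eqxx.
- split=> [g0|f0].
    apply: funext => y; rewrite -[y in LHS](idem_sum S (y : M)) (klin_sum fk) big1 // => v _.
    by rewrite [LHS]gf g0.
  by apply: funext => v; apply: funext => y; rewrite -gf f0.
Qed.

Lemma dim_C1a :
  has_quot_dim (@C1a k R S N M : set (J -> M -> kN)) [set 0]
    (\sum_a x (fsrc a) * n (ftgt a)).
Proof.
have sK a : subsp (khom (@idem_act M (fsrc a)) (@idem_range N (ftgt a))
    : set (kM -> kN)).
  exact/subsp_khom/subsp_idem_range.
have -> : (@C1a k R S N M : set (J -> M -> kN)) =
  [set g : J -> kM -> kN | forall a,
    khom (@idem_act M (fsrc a)) (@idem_range N (ftgt a)) (g a)].
  apply/seteqP; split=> g Cg a; have [gk gs gt] := Cg a; split=> // y.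
    exact/idem_rangeP.
  exact/idem_rangeP.
exact: (has_dim_family sK (fun a => dim_corner (fsrc a) (ftgt a))).
Qed.

Lemma khom_corner_TP u v (h : M -> T -> N) :
  (khom (@idem_act M w) (corner_T u v) : set (kM -> T -> kN)) h <->
  [/\ kbilin h, forall y s, h (E w *: y) s = h y s,
      forall y s, h y (eT u s) = h y s & forall y s, E v *: h y s = h y s].
Proof.
split=> [[h_lin hw hT]|[[hl hr] hw hs ht]].
  split=> [|y s|y s|y s].
  - split=> [s c y y'|y c s s'].
      exact: (congr1 (fun f : T -> N => f s) (h_lin c y y')).
    by have [h_r _ _] := hT y; exact: h_r.
  - exact: (congr1 (fun f : T -> N => f s) (hw y)).
  - by have [_ hs _] := hT y; exact: hs.
  - by have [_ _ ht] := hT y; apply/idem_rangeP; exact: ht.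
split=> [c y y'|y|y].
- by apply: funext => s; exact: (hl s c y y').
- by apply: funext => s; exact: hw.
- by split=> [c s s'|s|s]; [exact: hr | exact: hs | apply/idem_rangeP; exact: ht].
Qed.

Lemma dim_C2 :
  has_quot_dim (@C2 k R S N M : set (J -> M -> T -> kN)) [set 0]
    (\sum_a x w * (t (fsrc a) * n (ftgt a))).
Proof.
have sK a : subsp (khom (@idem_act M w) (corner_T (fsrc a) (ftgt a))
    : set (kM -> T -> kN)).
  exact/subsp_khom/subsp_corner_T.
have -> : (@C2 k R S N M : set (J -> M -> T -> kN)) =
  [set c : J -> kM -> T -> kN | forall a,
    khom (@idem_act M w) (corner_T (fsrc a) (ftgt a)) (c a)].
  by apply/seteqP; split=> c Cc a; apply/khom_corner_TP; exact: Cc.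
exact: (has_dim_family sK (fun a => dim_corner_T (fsrc a) (ftgt a))).
Qed.

Lemma dim_C1t :
  has_quot_dim (@C1t k R S N M : set (M -> T -> kN)) [set 0]
    (\sum_v x w * (t v * n v)).
Proof.
have sK v : subsp (khom (@idem_act M w) (corner_T v v)
    : set (kM -> T -> kN)).
  exact/subsp_khom/subsp_corner_T.
apply: (has_quot_dim_corr (rho := fun (g : V -> kM -> T -> kN) (h : kM -> T -> kN) =>
  forall v y s, h y (eT v s) = g v y s))
  (has_dim_family sK (fun v => dim_corner_T v v)).
- exact: (subsp_family sK).
- exact: subsp0.
- exact: subsp_C1t.
- exact: subsp0.
split=> [c g h g' h' gh gh' v y s|g Kg|h [[hl hr] hw hE]|g h Kg [[hl hr] hw hE] gh].
- by rewrite -[LHS]/(c *: h y (eT v s) + h' y (eT v s)) gh gh'.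
- have {}Kg v := (khom_corner_TP v v (g v)).1 (Kg v).
  have gv u v y s : g u y (eT v s) = if u == v then g v y s else 0.
    have [_ _ gE _] := Kg u; case: eqP => [<-|/eqP uv]; first exact: gE.
    rewrite -gE fidemT_mul (negPf uv).
    by apply: kbilin_r0; have [] := Kg u.
  have hsum v y s : \sum_u g u y (eT v s) = g v y s.
    rewrite (bigD1 v) //= gv eqxx big1 ?addr0 // => u uv.
    by rewrite gv (negPf uv).
  exists (fun y s => \sum_v g v y s : N); last exact: hsum.
  split=> [|y s|v y s].
  + split=> [s c y y'|y c s s'].
      rewrite scaler_sumr -big_split; apply: eq_bigr => v _ /=.
      by have [[gl _] _ _ _] := Kg v; exact: (gl s c y y').
    rewrite scaler_sumr -big_split; apply: eq_bigr => v _ /=.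
    by have [[_ gr] _ _ _] := Kg v; exact: gr.
  + by apply: eq_bigr => v _; have [_ gw _ _] := Kg v; exact: gw.
  + rewrite [LHS]hsum scaler_sumr (bigD1 v) //= big1 ?addr0 => [|u uv].
      by have [_ _ _ ->] := Kg v.
    have [_ _ _ <-] := Kg u.
    by rewrite idem_scale eq_sym (negPf uv).
- exists (fun v y s => h y (eT v s)) => //= v; apply/khom_corner_TP.
  split=> [|y s|y s|y s].
  + by split=> [s|y c s s']; [exact: hl | rewrite fidemT_lin; exact: hr].
  + exact: hw.
  + by rewrite fidemT_mul eqxx.
  + by rewrite hE idem_scale eqxx.
- split=> [g0|h0].
    apply: funext => y; apply: funext => s; rewrite -[h y s]/(h y s : N).
    have hs (F : V -> T) : h y (\sum_v F v) = \sum_v h y (F v) :> N.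
      have hD s1 s2 : h y (s1 + s2) = h y s1 + h y s2 :> N.
        by have := hr y 1 s1 s2; rewrite !scale1r.
      have hy0 : h y 0 = 0 :> N.
        by apply: (addIr (h y 0 : N)); rewrite -hD !add0r.
      by elim/big_rec2: _ => // v y1 y2 _ <-.
    by rewrite -(fidemT_sum s) hs big1 // => v _; rewrite [LHS]gh g0.
  apply: funext => v; apply: funext => y; apply: funext => s.
  by rewrite -gh h0.
Qed.

Lemma dim_C1 :
  has_quot_dim (@C1 k R S N M : set ((J -> M -> kN) * (M -> T -> kN))) [set 0]
    (\sum_a x (fsrc a) * n (ftgt a) + \sum_v x w * (t v * n v)).
Proof.
apply: (@has_dim_pair k (J -> M -> kN) (M -> T -> kN)) dim_C1a dim_C1t.
  exact: subsp_C1a.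
exact: subsp_C1t.
Qed.

End ComplexDimensions.

Section FrameEuler.
Variables (k : fieldType) (R : algType k) (S : frame R) (M N : lmodType R).
Hypothesis generated : forall (X : lmodType R) (f : X -> N),
  Z0 S f <-> linear f.
Hypothesis free_acyclic1 : forall X, acyclic1 S N (free_cover X).
Hypothesis free_acyclic2 : forall X, acyclic2 S N (free_cover X).
Variables (x n t : fvertex S -> nat).
Hypothesis dimM : forall v, has_quot_dim (@idem_range k R S M v) [set 0] (x v).
Hypothesis dimN : forall v, has_quot_dim (@idem_range k R S N v) [set 0] (n v).
Hypothesis dimT : forall v,
  has_quot_dim (range (@fidemT k R S v)) [set 0] (t v).

Lemma frame_ext_dims : exists h0 h1 h2,
  [/\ forall i, ext_findim M N i,
      [/\ ext_dim M N 0 = h0, ext_dim M N 1 = h1 & ext_dim M N 2 = h2],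
      forall i, (3 <= i)%N -> ext_dim M N i = 0%N
    & (h0 + h2 + (\sum_(a : farrow S) x (fsrc a) * n (ftgt a) +
         \sum_v x (fpt S) * (t v * n v)) =
       h1 + \sum_v x v * n v +
       \sum_(a : farrow S) x (fpt S) * (t (fsrc a) * n (ftgt a)))%N].
Proof.
have [h0 [h1 [h2 [H0 H1 H2 eqn]]]] := three_term_euler
  (subsp_C0 S N M) (subsp_C1 S N M) (subsp_C2 S N M)
  (@d0_lin k R S N M) (@d1_lin k R S N M)
  (@d0_C1 k R S N M) (@d1_C2 k R S N M) (@d1d0 k R S N M)
  (dim_C0 dimM dimN) (dim_C1 dimM dimN dimT) (dim_C2 dimM dimN dimT).
exists h0, h1, h2.
have E0 := ext_dim0 generated H0.
have E1 := ext_dim1 generated free_acyclic1 H1.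
have E2 := ext_dim2 generated free_acyclic1 free_acyclic2 H2.
have E3 i := ext_dim_ge3 M generated free_acyclic1 free_acyclic2 i.
split=> //.
- case=> [|[|[|i]]]; [by exists h0|by exists h1|by exists h2|by exists 0%N].
- by split; apply: quot_dimE => //; try exact: subsp_cocycle; exact: subsp_coboundary.
- move=> [|[|[|i]]] // _.
  by apply: quot_dimE => //; [exact: subsp_cocycle | exact: subsp_coboundary].
Qed.

End FrameEuler.

(** * The one-point extension of a path algebra *)

Lemma sum_option (Z : nmodType) (I : finType) (F : option I -> Z) :
  \sum_v F v = F None + \sum_i F (Some i).
Proof.
rewrite (bigD1 None) //=; congr (_ + _).
rewrite (reindex_omap Some id) /=; last by case.
by apply: eq_bigl => i; rewrite eqxx.
Qed.

Section PathAlgebraFacts.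
Variables (k : fieldType) (Q : quiver).
Local Notation A := (path_algebra k Q).
Local Notation e := (@vertex_idem k Q).

Lemma arrow_walk (a : arrow Q) : walk (source a) [:: a].
Proof. by rewrite /= eqxx. Qed.

Definition arrow_path (a : arrow Q) : qpath Q :=
  @QPath Q (source a, [:: a]) (arrow_walk a).

Definition arrow_elt (a : arrow Q) : A := pa_path k (arrow_path a).

Lemma pa_path_mul (p q : qpath Q) : pa_path k p * pa_path k q = path_mul k p q.
Proof. exact: pa_mulUU. Qed.

Lemma vertex_idem_path i p :
  e i * pa_path k p = if path_target p == i then pa_path k p else 0.
Proof.
by rewrite /vertex_idem pa_path_mul /path_mul path_comp1p; case: eqP.
Qed.

Lemma path_vertex_idem p i :
  pa_path k p * e i = if path_source p == i then pa_path k p else 0.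
Proof.
by rewrite /vertex_idem pa_path_mul /path_mul path_compp1; case: eqP.
Qed.

Lemma vertex_idem_mul i j : e i * e j = if i == j then e j else 0.
Proof. by rewrite vertex_idem_path eq_sym. Qed.

Lemma vertex_idem_sum : \sum_i e i = 1.
Proof. by []. Qed.

Lemma vertex_idem_arrow a : e (target a) * arrow_elt a = arrow_elt a.
Proof. by rewrite vertex_idem_path eqxx. Qed.

Lemma arrow_vertex_idem a : arrow_elt a * e (source a) = arrow_elt a.
Proof. by rewrite path_vertex_idem eqxx. Qed.

Lemma arrow_path_mul a p : path_target p <> source a ->
  arrow_elt a * pa_path k p = 0.
Proof. by move=> pa; rewrite pa_path_mul /path_mul path_compN. Qed.

Lemma walk_rcons i s (a : arrow Q) :
  walk i (rcons s a) = walk i s && (source a == walk_end i s).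
Proof. by rewrite -cats1 walk_cat /= andbT. Qed.

Lemma arrow_path_rcons a (p q : qpath Q) :
  val q = ((val p).1, rcons (val p).2 a) ->
  arrow_elt a * pa_path k p = pa_path k q.
Proof.
move=> qE; have pa : path_target p = path_source (arrow_path a).
  by have := valP q; rewrite qE /= walk_rcons => /andP[_ /eqP/esym].
have [r rE rv] := path_compP pa.
rewrite pa_path_mul /path_mul rE; congr (pa_path k _).
by apply: val_inj; rewrite rv qE /= cats1.
Qed.

(** Paths grow at their last arrow, because that is what left multiplication by
an arrow does. *)
Lemma qpath_ind (P : qpath Q -> Prop) :
  (forall i, P (trivial_path i)) ->
  (forall a p q, val q = ((val p).1, rcons (val p).2 a) -> P p -> P q) ->
  forall p, P p.
Proof.
move=> P0 PS [[i s] /= ws]; elim/last_ind: s ws => [|s a IHs] ws.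
  by rewrite (_ : @QPath Q (i, [::]) ws = trivial_path i) //; exact: val_inj.
have ws' : walk i s by move: ws; rewrite walk_rcons => /andP[].
exact: (PS a (@QPath Q (i, s) ws')).
Qed.

Lemma pa_linear_ind (P : A -> Prop) :
  P 0 -> (forall (c : k) x y, P x -> P y -> P (c *: x + y)) ->
  (forall p, P (pa_path k p)) -> forall x, P x.
Proof.
move=> P0 Plin Ppath x.
rewrite -[x](lift_basis (x : {malg k[qpath Q]})) /lift.
apply: (@big_rec A P 0 +%R) => // p y _ Py; apply: Plin => //.
by have := Ppath p; rewrite pa_path.unlock.
Qed.

Lemma pa_ind (P : A -> Prop) :
  P 0 -> (forall (c : k) x y, P x -> P y -> P (c *: x + y)) ->
  (forall i, P (e i)) -> (forall a x, P x -> P (arrow_elt a * x)) ->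
  forall x, P x.
Proof.
move=> P0 Plin Pe Par; apply: pa_linear_ind => //.
by apply: qpath_ind => // a p q qE Pp; rewrite -(arrow_path_rcons qE); exact: Par.
Qed.

Lemma pa_constE (c : k) (x : A) : pa_const Q c * x = c *: x.
Proof. by rewrite /pa_const -pa_scaleAl mul1r. Qed.

End PathAlgebraFacts.

Section OneQuiverExtension.
Variables (k : fieldType) (Q : quiver) (T : lmodType (path_algebra k Q)).
Local Notation A := (path_algebra k Q).
Local Notation R := (path_ope T).
Local Notation kT := (restr (pa_scalar k Q) T).
Local Notation e := (@vertex_idem k Q).

(** A constructor typed in the algebra, so that operations on its values are
those of kQ[T] and not those of the product type. *)
Definition mk_ope (x : A) (t : T) (l : k) : R := (x, t, l).

Lemma mk_opeM x t l y u m : mk_ope x t l * mk_ope y u m =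
  mk_ope (x * y) (x *: u + pa_const Q m *: t) (l * m).
Proof. by []. Qed.

Lemma mk_opeD x t l y u m :
  mk_ope x t l + mk_ope y u m = mk_ope (x + y) (t + u) (l + m).
Proof. by []. Qed.

Lemma mk_opeZ c x t l :
  c *: mk_ope x t l = mk_ope (c *: x) (pa_const Q c *: t) (c * l).
Proof.
rewrite -pa_constE.
by [].
Qed.

Lemma ope_eta (r : R) : exists x t l, r = mk_ope x t l.
Proof. by case: r => [[x t] l]; exists x, t, l. Qed.

Definition ope_idem (v : option (vertex Q)) : R :=
  if v is Some i then mk_ope (e i) 0 0 else mk_ope 0 0 1.

Definition ope_arrow (a : arrow Q) : R := mk_ope (arrow_elt k a) 0 0.

Definition ope_emb (t : kT) : R := mk_ope 0 t 0.

(** The new vertex is a source of the enlarged quiver: T has no component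
there. *)
Definition ope_idemT (v : option (vertex Q)) (t : kT) : kT :=
  if v is Some i then e i *: (t : T) else 0.

Definition ope_arrowT (a : arrow Q) (t : kT) : kT := arrow_elt k a *: (t : T).

Lemma ope_idem_mul u v :
  ope_idem u * ope_idem v = if u == v then ope_idem v else 0.
Proof.
case: u v => [i|] [j|]; rewrite mk_opeM !mul0r ?mulr0 ?scaler0 ?scale0r ?addr0 //.
  rewrite vertex_idem_mul -[Some i == Some j]/(i == j).
  by case: eqP.
by rewrite mulr1.
Qed.

Lemma ope_idem_sum : \sum_v ope_idem v = 1.
Proof.
rewrite sum_option /= -[RHS]/(mk_ope 1 0 1) -vertex_idem_sum.
have -> : \sum_i mk_ope (e i) 0 0 = mk_ope (\sum_i e i) 0 0.
  elim/big_rec2: _ => // i x y _ ->.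
  by rewrite mk_opeD !addr0.
by rewrite mk_opeD !add0r addr0.
Qed.

Lemma pa_const_scale c (x : A) (t : T) :
  x *: (pa_const Q c *: t) = pa_const Q c *: (x *: t).
Proof. by rewrite !scalerA pa_const_comm. Qed.

Definition ope_frame : frame R.
Proof.
apply: (@Frame k R (option (vertex Q)) (arrow Q)
  (fun a => Some (source a)) (fun a => Some (target a)) None kT
  ope_idem ope_arrow ope_emb ope_idemT ope_arrowT).
- exact: ope_idem_mul.
- exact: ope_idem_sum.
- by move=> a; rewrite mk_opeM vertex_idem_arrow !scaler0 addr0 mul0r.
- by move=> a; rewrite mk_opeM arrow_vertex_idem !scaler0 addr0 mul0r.
- move=> c t u; rewrite /ope_emb mk_opeZ mk_opeD scaler0 mulr0 !addr0.
  by [].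
- by move=> t; rewrite mk_opeM mulr0 scaler0 add0r rmorph1 scale1r mul0r.
- move=> [i|] t; rewrite mk_opeM ?mulr0 ?mul0r ?scaler0 ?rmorph0 ?scale0r ?addr0 //.
- by move=> a t; rewrite mk_opeM mulr0 rmorph0 scale0r addr0 mul0r.
- move=> [i|] c t u /=; last by rewrite scaler0 addr0.
  rewrite -[LHS]/(e i *: (pa_const Q c *: (t : T) + (u : T))).
  by rewrite scalerDr pa_const_scale.
- move=> a c t u; rewrite /ope_arrowT.
  rewrite -[LHS]/(arrow_elt k a *: (pa_const Q c *: (t : T) + (u : T))).
  by rewrite scalerDr pa_const_scale.
- move=> [i|] [j|] t //=; last by rewrite scaler0.
  rewrite scalerA vertex_idem_mul -[Some i == Some j]/(i == j).
  by case: eqP => // _; rewrite scale0r.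
- move=> t; rewrite sum_option /= add0r -[RHS](@scale1r _ T) -vertex_idem_sum.
  by rewrite scaler_suml.
- by move=> a t; rewrite /= /ope_arrowT scalerA vertex_idem_arrow.
- by move=> a t; rewrite /= /ope_arrowT scalerA arrow_vertex_idem.
Defined.

End OneQuiverExtension.

Section Generation.
Variables (k : fieldType) (Q : quiver) (T : lmodType (path_algebra k Q)).
Local Notation A := (path_algebra k Q).
Local Notation R := (path_ope T).
Local Notation S := (ope_frame T).
Local Notation ope a t l := (@mk_ope k Q T a t l).

Lemma mk_ope_split x t l :
  ope x t l = ope x 0 0 + (ope 0 t 0 + l *: ope 0 0 1).
Proof. by rewrite mk_opeZ !mk_opeD !scaler0 mulr1 !add0r !addr0. Qed.

Lemma lscaleA (X : lmodType R) (c : k) (r : R) (x : X) :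
  (c *: r) *: x = c%:A *: (r *: x).
Proof. by rewrite scalerA mulr_algl. Qed.

(** The idempotents, the arrows and T generate kQ[T]. *)
Lemma Z0_linear (X N : lmodType R) (f : X -> N) : Z0 S f <-> linear f.
Proof.
split=> [[[fk fE] df]|f_lin]; last first.
  have f0 := linear_map0 f_lin.
  have fZ r x : f (r *: x) = r *: f x by have := f_lin r x 0; rewrite f0 !addr0.
  split; first by split=> [c x y|v x]; [exact: f_lin | exact: fZ].
  by apply: (@cochain1_eq _ _ S) => [a x|x t]; rewrite /= fZ subrr.
pose P r := forall x, f (r *: x) = r *: f x.
have PD r s : P r -> P s -> P (r + s).
  by move=> Pr Ps x; rewrite !scalerDl (klinD fk) Pr Ps.
have PM r s : P r -> P s -> P (r * s).
  by move=> Pr Ps x; rewrite -!scalerA Pr Ps.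
have PZ c r : P r -> P (c *: r).
  by move=> Pr x; rewrite [X in f X]lscaleA (klinZ fk) Pr -lscaleA.
have PE v : P (ope_idem T v) by exact: fE.
have Pa a : P (ope_arrow T a).
  move=> x; apply/esym/eqP; rewrite -subr_eq0.
  by rewrite -[X in X == _]/((d0 S f).1 a x) df.
have Pt t : P (ope_emb t).
  move=> x; apply/esym/eqP; rewrite -subr_eq0.
  by rewrite -[X in X == _]/((d0 S f).2 x t) df.
have PA x : P (ope x 0 0).
  elim/pa_ind: x => [|c x y Px Py|i|a x Px].
  - by have := PZ 0 _ (PE None); rewrite scale0r.
  - have -> : ope (c *: x + y) 0 0 = c *: ope x 0 0 + ope y 0 0.
      by rewrite mk_opeZ mk_opeD scaler0 mulr0 !addr0.
    by apply: PD => //; exact: PZ.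
  - exact: (PE (Some i)).
  - have -> : ope (arrow_elt k a * x) 0 0 = ope_arrow T a * ope x 0 0.
      by rewrite mk_opeM !scaler0 mul0r addr0.
    exact: PM.
move=> r x y; rewrite (klinD fk); congr (_ + _).
have [a [t [l ->]]] := ope_eta r; move: x; rewrite -/(P _) mk_ope_split.
by apply: (PD _ _ (PA _)); apply: PD; [exact: Pt | apply: PZ; exact: (PE None)].
Qed.

End Generation.

(** * Acyclicity of free modules *)

(** The form in which freeness on the family gen is used: cochains are linear
over k only, so they are prescribed on all multiples of the basis elements. *)
Definition free_on (k : fieldType) (R : algType k) (N F : lmodType R) (X : Type)
    (gen : X -> F) : Prop :=
  (forall phi : X -> R -> N,
     (forall m, linear (phi m : R -> restr (in_alg R) N)) ->
     exists f : F -> N, klin f /\ forall r m, f (r *: gen m) = phi m r) /\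
  (forall f g : F -> N, klin f -> klin g ->
     (forall r m, f (r *: gen m) = g (r *: gen m)) -> forall x, f x = g x).

Section FreeExtension.
Variables (k : fieldType) (R : algType k) (X N : lmodType R).
Local Notation F := (free_cover X).
Local Notation kN := (restr (in_alg R) N).

(** The analogue of lift for values that depend on the coefficients only
k-linearly. *)
Definition klift (phi : X -> R -> N) (f : F) : N :=
  \sum_(m <- msupp (f : {malg R[X]})) phi m (f : {malg R[X]})@_m.

Variable phi : X -> R -> N.
Hypothesis phi_lin : forall m, linear (phi m : R -> kN).

Lemma klift_term0 m : phi m 0 = 0.
Proof. exact: (linear_map0 (phi_lin m)). Qed.

Lemma kliftEw (d : {fset X}) (f : F) :
  fsubset (msupp (f : {malg R[X]})) d ->
  klift phi f = \sum_(m <- d) phi m (f : {malg R[X]})@_m.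
Proof.
move=> fd; rewrite /klift (big_fset_incl _ fd) // => m md mf.
by rewrite mcoeff_outdom // klift_term0.
Qed.

Lemma klift_klin : klin (klift phi).
Proof.
move=> c f g; pose s (h : F) := msupp (h : {malg R[X]}).
pose d := fsetU (s f) (fsetU (s g) (s (c%:A *: f + g))).
rewrite (@kliftEw d f); last by rewrite /d fsubsetUl.
rewrite (@kliftEw d g); last by rewrite /d fsetUCA fsubsetUl.
rewrite (@kliftEw d (c%:A *: f + g)); last by rewrite /d fsetUA fsubsetUr.
rewrite scaler_sumr -big_split; apply: eq_bigr => m _ /=.
rewrite mcoeffD mcoeffZ mulr_algl; exact: phi_lin.
Qed.

Lemma kliftU r m : klift phi (r *: (<< m >> : F)) = phi m r.
Proof.
rewrite (@kliftEw [fset m]%fset); last first.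
  exact: (fsubset_trans (msuppZ_le _ _) msuppU_le).
by rewrite big_seq_fset1 mcoeffZ mcoeffUU mulr1.
Qed.

End FreeExtension.

Lemma free_cover_free (k : fieldType) (R : algType k) (X N : lmodType R) :
  free_on N (F := free_cover X) (fun m : X => << m >>).
Proof.
split=> [phi phi_lin|f g fk gk fg x].
  exists (klift phi); split; first exact: klift_klin.
  by move=> r m; exact: kliftU.
rewrite -[x](lift_basis (x : {malg R[X]})) /lift.
rewrite [LHS](klin_sum fk) [RHS](klin_sum gk).
by apply: eq_bigr => m _; exact: fg.
Qed.

Section Acyclicity.
Variables (k : fieldType) (Q : quiver) (T : lmodType (path_algebra k Q)).
Variables (N F : lmodType (path_ope T)) (X : Type) (gen : X -> F).
Hypothesis F_free : free_on N gen.
Local Notation A := (path_algebra k Q).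
Local Notation R := (path_ope T).
Local Notation S := (ope_frame T).
Local Notation ope a t l := (@mk_ope k Q T a t l).
Local Notation kN := (restr (in_alg R) N).
Local Notation kT := (restr (pa_scalar k Q) T).
Local Notation e := (@vertex_idem k Q).

Definition ope_space (r : R) : kT := r.1.2.

Lemma ope_space_lin : linear ope_space.
Proof. by []. Qed.

Lemma ope_idem_scale (Y : lmodType R) u v (y : Y) :
  ope_idem T u *: (ope_idem T v *: y) = if u == v then ope_idem T v *: y else 0.
Proof. by rewrite scalerA ope_idem_mul; case: eqP => // _; rewrite scale0r. Qed.

Lemma ope_arrow_source a :
  ope_arrow T a * ope_idem T (Some (source a)) = ope_arrow T a.
Proof. exact: (farr_src (f := S)). Qed.

(** On a basis element times r, the T-component of r can be read off, and
t w x is recovered from it; so a primitive with vanishing T-part exists. *)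
Lemma free_acyclic2 : acyclic2 S N F.
Proof.
have [F_ext F_uniq] := F_free.
move=> c Cc.
have /choice[g gP] (a : arrow Q) : exists f : F -> N, klin f /\
    forall r m, f (r *: gen m) = c a (gen m) (ope_space r).
  apply: F_ext => m b r s.
  by rewrite ope_space_lin; have [[_ cr] _ _ _] := Cc a; exact: cr.
have gk a : klin (g a) := (gP a).1.
have gU a r m : g a (r *: gen m) = c a (gen m) (ope_space r) := (gP a).2 r m.
exists (g, 0).
  split; last exact: (subsp_C1t S N F).1.
  move=> a; have [[cl cr] cw cs ct] := Cc a; split=> [|x|x]; first exact: gk.
    apply: (F_uniq _ _ (klin_comp (gk a) (@klin_scale _ _ _ _)) (gk a)).
    move=> r m; rewrite scalerA !gU -[RHS]cs; congr (c a _ _).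
    have [y [t [l ->]]] := ope_eta r.
    by rewrite mk_opeM /ope_space /= scaler0 addr0.
  apply: (F_uniq _ _ (klin_comp (@klin_scale _ _ _ _) (gk a)) (gk a)).
  by move=> r m; rewrite gU ct.
apply: (@cochain2_eq _ _ S) => a x t.
have [[cl cr] cw cs ct] := Cc a.
rewrite -[LHS]/(ope_arrow T a *: 0 - 0 + g a (ope_emb t *: x) : N).
rewrite scaler0 subr0 add0r; move: x.
apply: (F_uniq _ _ (klin_comp (gk a) (@klin_scale _ _ _ _)) (cl t)) => r m.
rewrite scalerA gU -[RHS]cw scalerA.
have [y [s [l ->]]] := ope_eta r.
have -> : ope_emb t * ope y s l = ope 0 (pa_const Q l *: (t : T)) 0.
  by rewrite mk_opeM !mul0r scale0r add0r.
have -> : (ope_idem T None) * ope y s l = l *: ope 0 0 1.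
  rewrite mk_opeM mk_opeZ mulr1 mul1r mul0r scale0r !scaler0 addr0.
  by [].
rewrite lscaleA (klinZ (cl t)) -[ope 0 0 1]/(ope_idem T None) cw.
have := cr (gen m) l t 0.
by rewrite (kbilin_r0 (S := S)) ?addr0 //; split.
Qed.

(** Given a 1-cocycle, the values of a primitive on the paths applied to one
basis element are forced, arrow by arrow, once it vanishes on trivial paths. *)
Section PathPrimitive.
Variables (g : arrow Q -> F -> N) (m : X).
Hypothesis Cg : @C1a k R S N F g.

(** The first component accumulates the path itself, on which g is evaluated at
the next arrow. *)
Definition path_step (y : A * N) (a : arrow Q) : A * N :=
  (arrow_elt k a * y.1, ope_arrow T a *: y.2 - g a (ope y.1 0 0 *: gen m)).

Definition path_primitive (p : qpath Q) : kN :=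
  (foldl path_step (e (val p).1, 0) (val p).2).2.

Lemma path_step_elt p :
  (foldl path_step (e (val p).1, 0) (val p).2).1 = pa_path k p.
Proof.
elim/qpath_ind: p => // a p q qE IH.
by rewrite qE foldl_rcons /= IH; exact: arrow_path_rcons.
Qed.

Lemma path_primitive_rcons a (p q : qpath Q) :
  val q = ((val p).1, rcons (val p).2 a) ->
  path_primitive q =
    ope_arrow T a *: (path_primitive p : N) - g a (ope (pa_path k p) 0 0 *: gen m).
Proof.
by move=> qE; rewrite /path_primitive qE foldl_rcons /= path_step_elt.
Qed.

Lemma path_primitive_target p :
  ope_idem T (Some (path_target p)) *: (path_primitive p : N) = path_primitive p.
Proof.
elim/qpath_ind: p => [i|a p q qE _]; first exact: scaler0.
have -> : path_target q = target a.
  by rewrite /path_target qE /walk_end map_rcons last_rcons.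
have [gk gs gt] := Cg a.
rewrite (path_primitive_rcons qE) scalerBr scalerA.
by rewrite [_ * ope_arrow T a](farr_tgt (f := S)) [X in _ - X]gt.
Qed.

Definition primitive (x : A) : kN := Defs.lift path_primitive (x : {malg k[qpath Q]}).

Lemma primitive_lin : linear primitive.
Proof. by move=> c x y; rewrite /primitive linearP. Qed.

Lemma primitive0 : primitive 0 = 0.
Proof. exact: raddf0. Qed.

Lemma primitive_path p : primitive (pa_path k p) = path_primitive p.
Proof. by rewrite /primitive pa_path.unlock liftU. Qed.

Lemma primitive_idem i x :
  primitive (e i * x) = ope_idem T (Some i) *: (primitive x : N).
Proof.
elim/pa_linear_ind: x => [|c x y IHx IHy|p].
- by rewrite mulr0 primitive0 [RHS]scaler0.
- rewrite mulrDr -pa_scaleAr !primitive_lin IHx IHy.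
  rewrite -[RHS]/(ope_idem T (Some i) *: (c%:A *: (primitive x : N) + primitive y)).
  by rewrite scalerDr -scalar_commute.
- rewrite vertex_idem_path; have [<-|pi] := eqVneq.
    by rewrite primitive_path path_primitive_target.
  rewrite primitive0 primitive_path -path_primitive_target.
  by rewrite [RHS]ope_idem_scale eq_sym (inj_eq Some_inj) (negPf pi).
Qed.

Lemma primitive_pt x : ope_idem T None *: (primitive x : N) = 0.
Proof.
elim/pa_linear_ind: x => [|c x y IHx IHy|p]; first by rewrite primitive0 scaler0.
  rewrite primitive_lin.
  rewrite -[LHS]/(ope_idem T None *: (c%:A *: (primitive x : N) + primitive y)).
  by rewrite scalerDr -scalar_commute IHx IHy scaler0 addr0.
rewrite primitive_path -path_primitive_target.
exact: ope_idem_scale.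
Qed.

Lemma primitive_arrow a x :
  primitive (arrow_elt k a * x) =
    ope_arrow T a *: (primitive x : N) - g a (ope x 0 0 *: gen m).
Proof.
have [gk gs gt] := Cg a.
elim/pa_linear_ind: x => [|c x y IHx IHy|p].
- rewrite mulr0 primitive0 scaler0 -[ope 0 0 0]/(0 : R) scale0r (klin0 gk) subr0.
  by [].
- rewrite mulrDr -pa_scaleAr !primitive_lin IHx IHy.
  have -> : ope (c *: x + y) 0 0 = c *: ope x 0 0 + ope y 0 0.
    by rewrite mk_opeZ mk_opeD scaler0 mulr0 !addr0.
  rewrite scalerDl lscaleA gk.
  rewrite -[LHS]/(c%:A *: (ope_arrow T a *: (primitive x : N) - g a (ope x 0 0 *: gen m))
    + (ope_arrow T a *: (primitive y : N) - g a (ope y 0 0 *: gen m)) : N).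
  rewrite -[RHS]/(ope_arrow T a *: (c%:A *: (primitive x : N) + primitive y) -
    (c%:A *: g a (ope x 0 0 *: gen m) + g a (ope y 0 0 *: gen m)) : N).
  by rewrite !scalerDr scalerN opprD addrACA scalar_commute.
- have [pa|pa] := eqVneq (path_target p) (source a).
    have [q qE qv] := path_compP (p := arrow_path a) pa.
    have qr : val q = ((val p).1, rcons (val p).2 a) by rewrite qv /= cats1.
    by rewrite (arrow_path_rcons k qr) !primitive_path (path_primitive_rcons qr).
  rewrite arrow_path_mul ?primitive0; last exact/eqP.
  have gs' y : g a (ope_idem T (Some (source a)) *: y) = g a y by exact: gs.
  rewrite primitive_path -path_primitive_target -gs' [X in g a X]scalerA.
  have -> : ope_idem T (Some (source a)) * ope (pa_path k p) 0 0 = 0.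
    rewrite mk_opeM vertex_idem_path (negPf pa) !scaler0 addr0 mul0r.
    by [].
  rewrite scale0r (klin0 gk) subr0 -[ope_arrow T a]ope_arrow_source -scalerA.
  by rewrite ope_idem_scale (inj_eq Some_inj) eq_sym (negPf pa) scaler0.
Qed.

End PathPrimitive.

(** A primitive that vanishes on w times the basis is forced to be - h on T; on
paths it is found by integration along the arrows. The cocycle condition makes
this choice on T compatible with the arrows. *)
Lemma free_acyclic1 : acyclic1 S N F.
Proof.
have [F_ext F_uniq] := F_free.
move=> [g h] [[/= Cg Ch] dgh]; have [[hl hr] hw hE] := Ch.
have hE' v x t : h x (ope_idemT v t) = ope_idem T v *: h x t by exact: hE.
have h0 x : h x 0 = 0 :> N by apply: (kbilin_r0 (S := S)).
pose phi m (r : R) : N := primitive g m r.1.1 - h (gen m) (ope_space r).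
have phiE m x t l : phi m (ope x t l) = primitive g m x - h (gen m) t by [].
have [|f [fk fU]] := F_ext phi.
  move=> m c r s; rewrite /phi -[(c *: r + s).1.1]/(pa_const Q c * r.1.1 + s.1.1).
  rewrite pa_constE primitive_lin ope_space_lin hr.
  rewrite -[LHS]/(c%:A *: (primitive g m r.1.1 : N) + primitive g m s.1.1 -
    (c%:A *: h (gen m) (ope_space r) + h (gen m) (ope_space s)) : N).
  rewrite opprD addrACA -scalerBr.
  by [].
have wphi m r : ope_idem T None *: phi m r = 0.
  have [x [t [l ->]]] := ope_eta r.
  rewrite phiE scalerBr (primitive_pt m Cg) sub0r -hE'.
  by rewrite [h _ _]h0 oppr0.
have Cf : C0 S f.
  split=> // v; apply: (F_uniq _ _ (klin_comp fk (@klin_scale _ _ _ _))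
    (klin_comp (@klin_scale _ _ _ _) fk)) => r m.
  rewrite scalerA !fU; case: v => [i|].
    have [x [t [l ->]]] := ope_eta r.
    rewrite mk_opeM !phiE scaler0 addr0 scalerBr -hE'.
    by rewrite (primitive_idem m Cg).
  rewrite [RHS]wphi; have [x [t [l ->]]] := ope_eta r.
  rewrite mk_opeM phiE mul0r scale0r scaler0 addr0 h0 subr0.
  exact: primitive0.
have dghE a x t : g a (ope_emb t *: x) =
    h x (ope_arrowT a t) - ope_arrow T a *: h x t.
  have : ope_arrow T a *: h x t - h x (ope_arrowT a t) + g a (ope_emb t *: x) =
    0 :> N by exact: (congr1 (fun c => c a x t) dgh).
  by move/eqP; rewrite addrC addr_eq0 opprB => /eqP.
have hw' x t : h (ope_idem T None *: x) t = h x t by exact: hw.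
have [da [[dl _] _ _]] := d0_C1 Cf.
exists f => //; apply: (@cochain1_eq _ _ S) => [a|x t].
  have [gk gs gt] := Cg a; have [dk _ _] := da a.
  have gs' y : g a (ope_idem T (Some (source a)) *: y) = g a y by exact: gs.
  apply: (F_uniq _ _ dk gk) => r m.
  rewrite -[LHS]/(ope_arrow T a *: f (r *: gen m) -
    f (ope_arrow T a *: (r *: gen m)) : N).
  rewrite scalerA !fU; have [y [t [l ->]]] := ope_eta r.
  have gw : g a ((l *: ope 0 0 1) *: gen m) = 0.
    rewrite -gs' scalerA -scalerAr -[ope 0 0 1]/(ope_idem T None) ope_idem_mul.
    by rewrite scaler0 scale0r (klin0 gk).
  rewrite [in RHS]mk_ope_split !scalerDl !(klinD gk) gw addr0.
  rewrite -[ope 0 t 0]/(ope_emb t) dghE mk_opeM !phiE primitive_arrow //.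
  rewrite scaler0 addr0 scalerBr.
  have -> : ope_arrowT a t = arrow_elt k a *: (t : T) by [].
  rewrite !opprB addrC [X in X + _]addrA.
  by rewrite addrA subrK [RHS]addrA [g a _ + _]addrC.
move: x; apply: (F_uniq _ _ (dl t) (hl t)) => r m.
rewrite -[LHS]/(ope_emb t *: f (r *: gen m) -
  f (ope_emb t *: (r *: gen m)) : N).
rewrite scalerA !fU -[RHS]hw' scalerA.
have -> : ope_emb t *: phi m r = 0.
  by rewrite -[ope_emb t](femb_pt (f := S)) -scalerA [X in _ *: X]wphi scaler0.
have [y [s [l ->]]] := ope_eta r.
have -> : ope_emb t * ope y s l = ope 0 (pa_const Q l *: (t : T)) 0.
  by rewrite mk_opeM !mul0r scale0r add0r.
have -> : (ope_idem T None) * ope y s l = l *: ope 0 0 1.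
  rewrite mk_opeM mk_opeZ mulr1 mul1r mul0r scale0r !scaler0 addr0.
  by [].
rewrite lscaleA (klinZ (hl t)) -[ope 0 0 1]/(ope_idem T None) hw'.
rewrite phiE primitive0 !sub0r opprK.
have := hr (gen m) l t 0.
by rewrite h0 !addr0.
Qed.

End Acyclicity.

(** * The Euler form *)

Lemma has_subspace_dim (k : fieldType) (V : lmodType k) (U : set V) :
  findim V -> subsp U -> has_quot_dim U [set 0] (subspace_dim U).
Proof.
move=> [n Vn] sU; have U0 : [set 0] `<=` U by move=> _ ->; exact: sU.1.
have [_ [m Um]] := quot_findim_split (@subspT k V) sU (@subsp0 k V) U0 (@subsetT _ _) Vn.
exact: (@xgetPex _ 0%N [set n | has_quot_dim U [set 0] n] (ex_intro _ m Um)).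
Qed.

Section EulerForm.
Variables (k : fieldType) (Q : quiver) (T : lmodType (path_algebra k Q)).
Hypothesis hT : findim (restr (pa_scalar k Q) T).
Variables M N : lmodType (path_ope T).
Hypothesis hM : findim (restr (in_alg (path_ope T)) M).
Hypothesis hN : findim (restr (in_alg (path_ope T)) N).
Local Notation R := (path_ope T).
Local Notation S := (ope_frame T).
Local Notation kT := (restr (pa_scalar k Q) T).
Local Notation kN := (restr (in_alg R) N).

(** Dimension vectors with the new vertex as None. *)
Definition vertex_dim (X : lmodType R) (v : option (vertex Q)) : nat :=
  if v is Some i then (ope_dimvec X).2 i else (ope_dimvec X).1.

Definition vertex_dimT (v : option (vertex Q)) : nat :=
  if v is Some i then quiver_dimvec T i else 0%N.

Lemma has_vertex_dim (X : lmodType R) : findim (restr (in_alg R) X) ->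
  forall v, has_quot_dim (@idem_range k R S X v) [set 0] (vertex_dim X v).
Proof.
move=> hX v; have sv := @subsp_idem_range k R S X v.
by have := has_subspace_dim hX sv; case: v sv => [i|] sv.
Qed.

Lemma has_vertex_dimT v :
  has_quot_dim (range (@fidemT k R S v)) [set 0] (vertex_dimT v).
Proof.
case: v => [i|].
  apply: (has_subspace_dim hT (U := range (@fidemT k R S (Some i)))).
  by apply: (@subsp_image k kT kT); [exact: (@fidemT_lin k R S (Some i)) | exact: subspT].
have -> : range (@fidemT k R S None) = [set 0].
  by apply/seteqP; split=> [_ [x _ <-]|_ ->] //=; exists 0.
by apply: has_quot_dim0; [exact: subsp0 | | exact: subsp0].
Qed.

End EulerForm.

Lemma ope_euler_form_dims (k : fieldType) (Q : quiver)
    (T : lmodType (path_algebra k Q)) (m n : nat * (vertex Q -> nat))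
    (x y t : option (vertex Q) -> nat) (h0 h1 h2 : nat) :
  x None = m.1 -> y None = n.1 -> t None = 0%N ->
  (forall i, x (Some i) = m.2 i) -> (forall i, y (Some i) = n.2 i) ->
  (forall i, t (Some i) = quiver_dimvec T i) ->
  (h0 + h2 +
    (\sum_(a : arrow Q) x (Some (source a)) * y (Some (target a)) +
     \sum_v x None * (t v * y v)) =
    h1 + \sum_v x v * y v +
    \sum_(a : arrow Q) x None * (t (Some (source a)) * y (Some (target a))))%N ->
  h0%:Z - h1%:Z + h2%:Z = ope_euler_form T m n.
Proof.
move=> x0 y0 t0 xE yE tE.
have sum_optionN (F : option (vertex Q) -> nat) :
  (\sum_v F v = F None + \sum_i F (Some i))%N := sum_option F.
rewrite !sum_optionN x0 y0 t0 mul0n muln0 add0n -!big_distrr /=.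
under [X in (_ = _ + (_ + X) + _)%N -> _]eq_bigr do rewrite xE yE.
under eq_bigr do rewrite xE yE.
under [X in (_ + (_ + _ * X) = _)%N -> _]eq_bigr do rewrite tE yE.
under [X in (_ = _ + _ * X)%N -> _]eq_bigr do rewrite tE yE.
rewrite /ope_euler_form /quiver_euler_form.
rewrite -!(big_morph Posz PoszD (erefl 0%:Z)) mulrBr -!PoszM.
lia.
Qed.

Theorem corollary3p10 (k : closedFieldType) (Q : quiver)
    (T : lmodType (path_algebra k Q)) (hT : findim (restr (pa_scalar k Q) T))
    (M N : lmodType (path_ope T))
    (hM : findim (restr (in_alg (path_ope T)) M))
    (hN : findim (restr (in_alg (path_ope T)) N)) :
  [/\ forall n, ext_findim M N n,
      exists m, forall n, (m <= n)%N -> ext_dim M N n = 0%N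
    & homological_euler_form M N =
        ope_euler_form T (ope_dimvec M) (ope_dimvec N)].
Proof.
have [h0 [h1 [h2 [fin [E0 E1 E2] E3 eqn]]]] := frame_ext_dims
  (fun X f => @Z0_linear k Q T X N f)
  (fun X => free_acyclic1 (free_cover_free X N))
  (fun X => free_acyclic2 (free_cover_free X N))
  (has_vertex_dim hM) (has_vertex_dim hN) (has_vertex_dimT hT).
split=> //; first by exists 3%N.
have -> : homological_euler_form M N = h0%:Z - h1%:Z + h2%:Z.
  rewrite /homological_euler_form (fsbigE [:: 0%N; 1%N; 2%N]) //.
    rewrite !big_cons big_nil !in_setT E0 E1 E2 expr0 expr1 mul1r mulN1r.
    by rewrite sqrrN expr1n mul1r /= addr0 addrA.
  move=> n _; case: n => [|[|[|n]]] // _.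
  by rewrite E3 // mulr0.
exact: ope_euler_form_dims eqn.
Qed.
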